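(* Let $D(\boldsymbol{\mathfrak g}_d,\boldsymbol\beta_d)\in\boldsymbol A_d$ be the Dirac operator of the deformation family of $G(\mathbb R)$, $D_0\in A_0$ the Dirac operator of the Cartan motion group $G(\mathbb R)_0$, and $\Phi_A:\boldsymbol A_d|_0\to A_0$ the canonical algebra isomorphism (defined in the context). Then $$\Phi_A\bigl(D(\boldsymbol{\mathfrak g}_d,\boldsymbol\beta_d)+z\boldsymbol A_d\bigr)=D_0.$$
   Context: Setting. $G$ is a connected complex reductive algebraic group with an antiholomorphic involution $\sigma$ such that $G(\mathbb R):=G^\sigma$ is connected and noncompact; $\theta$ is a corresponding Cartan involution of $G$ (commuting with $\sigma$); $K:=G^\theta$ and $K(\mathbb R):=K^\sigma$ is a maximal compact subgroup of $G(\mathbb R)$. Put $\mathfrak g=\mathrm{Lie}(G)=\mathfrak k\oplus\mathfrak p$, the $\pm1$-eigenspaces of $\theta$, with real forms $\mathfrak g^\sigma=\mathfrak k^\sigma\oplus\mathfrak p^\sigma$. The Cartan motion group is $G(\mathbb R)_0=\mathfrak p^\sigma\rtimes K(\mathbb R)$, with complexified Lie algebra $\mathfrak g_0=\mathfrak k\oplus\mathfrak p_0$, $\mathfrak p_0=\mathfrak p$ as a $K$-module, and bracket $[X_1+Y_1,X_2+Y_2]_0=[Y_1,X_2]+[X_1,Y_2]+[Y_1,Y_2]$ for $X_i\in\mathfrak p$, $Y_i\in\mathfrak k$. Form. Fix a symmetric bilinear form $\beta$ on $\mathfrak g$ which restricts to the Killing form on $[\mathfrak g,\mathfrak g]$,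 is positive definite on $\mathfrak p^\sigma$ and negative definite on $\mathfrak k^\sigma$, and is $\theta$-, $K$- and $\mathfrak g$-invariant. Put $\beta_0=\beta|_{\mathfrak p_0\times\mathfrak p_0}$. Clifford algebras. For a module $M$ with symmetric bilinear form $B$ over a commutative ring, $\operatorname{Cl}(M,B)$ is the tensor algebra modulo the two-sided ideal generated by $X\otimes Y+Y\otimes X-B(X,Y)$. $A_0=\mathcal U(\mathfrak g_0)\otimes_{\mathbb C}\operatorname{Cl}(\mathfrak p_0,\beta_0)$, with $\gamma_0:\mathfrak p_0\to\operatorname{Cl}(\mathfrak p_0,\beta_0)$ the canonical embedding, and $D_0=\sum_i e_i\otimes\gamma_0(e_i')\in A_0$ for any basis $\{e_i\}$ of $\mathfrak p_0$ with $\beta_0$-dual basis $\{e_i'\}$. Deformation family. $\boldsymbol{\mathfrak g}_d=\boldsymbol{\mathfrak k}\oplus\boldsymbol{\mathfrak p}_d\subset\mathbb C[z]\otimes_{\mathbb C}\mathfrak g$ with $\boldsymbol{\mathfrak k}=\mathbb C[z]\otimes\mathfrak k$ and $\boldsymbol{\mathfrak p}_d=z\mathbb C[z]\otimes\mathfrak p$, a Lie algebra over $\mathbb C[z]$. $\mathcal U(\boldsymbol{\mathfrak g}_d)$ is its enveloping algebra over $\mathbb C[z]$. $\boldsymbol\beta_d$ is the $\mathbb C[z]$-bilinear form on $\boldsymbol{\mathfrak p}_d$ with $z^2\boldsymbol\beta_d=(1\otimes\beta)|_{\boldsymbol{\mathfrak p}_d\times\boldsymbol{\mathfrak p}_d}$;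 it is unimodular. $\boldsymbol A_d=\mathcal U(\boldsymbol{\mathfrak g}_d)\otimes_{\mathbb C[z]}\operatorname{Cl}(\boldsymbol{\mathfrak p}_d,\boldsymbol\beta_d)$, and $\boldsymbol\gamma_d:\boldsymbol{\mathfrak p}_d\to\operatorname{Cl}(\boldsymbol{\mathfrak p}_d,\boldsymbol\beta_d)$ is the canonical embedding. The Dirac operator $D(\boldsymbol{\mathfrak g}_d,\boldsymbol\beta_d)$ is the image in $\boldsymbol A_d$, under $X\otimes Y\mapsto X\otimes\boldsymbol\gamma_d(Y)$, of the element of $\boldsymbol{\mathfrak p}_d\otimes_{\mathbb C[z]}\boldsymbol{\mathfrak p}_d$ corresponding to $\operatorname{Id}_{\boldsymbol{\mathfrak p}_d}$ via $\operatorname{End}_{\mathbb C[z]}(\boldsymbol{\mathfrak p}_d)\cong\boldsymbol{\mathfrak p}_d^*\otimes\boldsymbol{\mathfrak p}_d\cong\boldsymbol{\mathfrak p}_d\otimes\boldsymbol{\mathfrak p}_d$ (using $\boldsymbol\beta_d$); for a $\beta_0$-orthonormal basis $\{X_i\}$ of $\mathfrak p_0$ it equals $\sum_i(z\otimes X_i)\otimes\boldsymbol\gamma_d(z\otimes X_i)$. For a $\mathbb C[z]$-module $M$, its zero fiber is $M|_0=M/zM$. The isomorphism $\Phi_A$. Identify $\boldsymbol A_d|_0\cong\mathcal U(\boldsymbol{\mathfrak g}_d)|_0\otimes_{\mathbb C}\operatorname{Cl}(\boldsymbol{\mathfrak p}_d,\boldsymbol\beta_d)|_0$ and put $\Phi_A=\Phi_U\otimes\Phi_{\mathrm{Cl}}$.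 Here $\Phi_U:\mathcal U(\boldsymbol{\mathfrak g}_d)|_0\to\mathcal U(\mathfrak g_0)$ is the composite of the inverse of the base-change isomorphism $\mathcal U(\boldsymbol{\mathfrak g}_d|_0)\to\mathcal U(\boldsymbol{\mathfrak g}_d)|_0$ with the map induced by the Lie algebra isomorphism $\eta:\boldsymbol{\mathfrak g}_d|_0\to\mathfrak g_0$, where $\eta(f\otimes X+z\boldsymbol{\mathfrak g}_d)$ equals $f(0)X$ for $X\in\mathfrak k$ and $f'(0)X$ for $X\in\mathfrak p$ (with $f\in z\mathbb C[z]$ in the latter case). $\Phi_{\mathrm{Cl}}:\operatorname{Cl}(\boldsymbol{\mathfrak p}_d,\boldsymbol\beta_d)|_0\to\operatorname{Cl}(\mathfrak p,\beta|_{\mathfrak p})=\operatorname{Cl}(\mathfrak p_0,\beta_0)$ is the composite of the inverse of the base-change isomorphism $\operatorname{Cl}(\boldsymbol{\mathfrak p}_d|_0,\boldsymbol\beta_d|_0)\to\operatorname{Cl}(\boldsymbol{\mathfrak p}_d,\boldsymbol\beta_d)|_0$ with the isomorphism induced by the isometry $\boldsymbol{\mathfrak p}_d|_0\to\mathfrak p$, $zg\otimes X+z\boldsymbol{\mathfrak p}_d\mapsto g(0)X$ ($g\in\mathbb C[z]$). *)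

(* Defs.v *)
From HB Require Import structures.
From mathcomp Require Import all_boot all_order all_algebra complex.
From mathcomp Require Import all_classical all_reals all_analysis.

Set Implicit Arguments.
Unset Strict Implicit.
Unset Printing Implicit Defensive.

Import Order.TTheory GRing.Theory Num.Theory.

Local Open Scope ring_scope.
Local Open Scope quotient_scope.

(* Associative unital algebras. The library's algType excludes the zero ring, *)
(* which a Clifford algebra over a general commutative ring may be.           *)
HB.mixin Record isAssocAlg (R : comNzRingType) A of GRing.Lmodule R A := {
  amul : A -> A -> A;
  aone : A;
  amulA : associative amul;
  amul1l : left_id aone amul;
  amul1r : right_id aone amul;
  amul_linearl : forall y a u v,
    amul (a *: u + v) y = a *: amul u y + amul v y;
  amul_linearr : forall x a u v,
    amul x (a *: u + v) = a *: amul x u + amul x v }.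

#[short(type="assocAlgType")]
HB.structure Definition AssocAlg (R : comNzRingType) :=
  {A of GRing.Lmodule R A & isAssocAlg R A}.

HB.mixin Record isLie (R : comNzRingType) L of GRing.Lmodule R L := {
  lie : L -> L -> L;
  lie_linearl : forall y a u v, lie (a *: u + v) y = a *: lie u y + lie v y;
  lie_linearr : forall x a u v, lie x (a *: u + v) = a *: lie x u + lie x v;
  liexx : forall x, lie x x = 0;
  lie_jacobi : forall x y t,
    lie x (lie y t) + lie y (lie t x) + lie t (lie x y) = 0 }.

#[short(type="lieAlgType")]
HB.structure Definition LieAlgebra (R : comNzRingType) :=
  {L of GRing.Lmodule R L & isLie R L}.

#[short(type="lieVectType")]
HB.structure Definition LieVector (R : comNzRingType) :=
  {L of LieAlgebra R L & Vector R L}.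

(* Finite-dimensional Lie algebras with an involutive automorphism. *)
HB.mixin Record hasInvolution (R : comNzRingType) L of LieVector R L := {
  theta : L -> L;
  theta_linear : forall a u v, theta (a *: u + v) = a *: theta u + theta v;
  thetaK : forall x, theta (theta x) = x;
  theta_lie : forall x y, theta (lie x y) = lie (theta x) (theta y) }.

#[short(type="symLieType")]
HB.structure Definition SymLie (R : comNzRingType) :=
  {L of LieVector R L & hasInvolution R L}.

Section AssocTheory.
Variables (R : comNzRingType) (A : assocAlgType R).
Implicit Types x y : A.

Lemma amulDl x1 x2 y : amul (x1 + x2) y = amul x1 y + amul x2 y.
Proof. by have := amul_linearl y 1 x1 x2; rewrite !scale1r. Qed.
Lemma amulDr x y1 y2 : amul x (y1 + y2) = amul x y1 + amul x y2.
Proof. by have := amul_linearr x 1 y1 y2; rewrite !scale1r. Qed.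
Lemma amul0x y : amul 0 y = 0.
Proof. by apply: (addrI (amul 0 y)); rewrite -amulDl !addr0. Qed.
Lemma amulx0 x : amul x 0 = 0.
Proof. by apply: (addrI (amul x 0)); rewrite -amulDr !addr0. Qed.
Lemma amulZl a x y : amul (a *: x) y = a *: amul x y.
Proof. by have := amul_linearl y a x 0; rewrite amul0x !addr0. Qed.
Lemma amulZr a x y : amul x (a *: y) = a *: amul x y.
Proof. by have := amul_linearr x a y 0; rewrite amulx0 !addr0. Qed.
Lemma amulBl x1 x2 y : amul (x1 - x2) y = amul x1 y - amul x2 y.
Proof. by rewrite amulDl -scaleN1r amulZl scaleN1r. Qed.
Lemma amulBr x y1 y2 : amul x (y1 - y2) = amul x y1 - amul x y2.
Proof. by rewrite amulDr -scaleN1r amulZr scaleN1r. Qed.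

End AssocTheory.

Section LieTheory.
Variables (R : comNzRingType) (L : lieAlgType R).
Implicit Types x y : L.

Lemma lieDl x1 x2 y : lie (x1 + x2) y = lie x1 y + lie x2 y.
Proof. by have := lie_linearl y 1 x1 x2; rewrite !scale1r. Qed.
Lemma lieDr x y1 y2 : lie x (y1 + y2) = lie x y1 + lie x y2.
Proof. by have := lie_linearr x 1 y1 y2; rewrite !scale1r. Qed.
Lemma lie0x y : lie 0 y = 0.
Proof. by apply: (addrI (lie 0 y)); rewrite -lieDl !addr0. Qed.
Lemma liex0 x : lie x 0 = 0.
Proof. by apply: (addrI (lie x 0)); rewrite -lieDr !addr0. Qed.
Lemma lieZl a x y : lie (a *: x) y = a *: lie x y.
Proof. by have := lie_linearl y a x 0; rewrite lie0x !addr0. Qed.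
Lemma lieZr a x y : lie x (a *: y) = a *: lie x y.
Proof. by have := lie_linearr x a y 0; rewrite liex0 !addr0. Qed.
Lemma lieC x y : lie x y = - lie y x.
Proof.
apply/eqP; rewrite -addr_eq0; apply/eqP.
by have := liexx (x + y); rewrite lieDl !lieDr !liexx add0r addr0.
Qed.
Lemma lieNl x y : lie (- x) y = - lie x y.
Proof. by rewrite -scaleN1r lieZl scaleN1r. Qed.
Lemma lieNr x y : lie x (- y) = - lie x y.
Proof. by rewrite -scaleN1r lieZr scaleN1r. Qed.
Lemma lie_suml (I : Type) (s : seq I) (F : I -> L) y :
  lie (\sum_(i <- s) F i) y = \sum_(i <- s) lie (F i) y.
Proof. by elim/big_rec2: _ => [|i u v _ <-]; rewrite ?lie0x ?lieDl. Qed.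
Lemma lie_sumr (I : Type) (s : seq I) (F : I -> L) x :
  lie x (\sum_(i <- s) F i) = \sum_(i <- s) lie x (F i).
Proof. by elim/big_rec2: _ => [|i u v _ <-]; rewrite ?liex0 ?lieDr. Qed.

End LieTheory.

Section Tensor.
Variables (R : comNzRingType) (M N : lmodType R).

(* A finite sequence of pairs stands for the sum of the pure tensors. *)
Inductive tens_eqv : seq (M * N) -> seq (M * N) -> Prop :=
| TE_refl s : tens_eqv s s
| TE_sym s t : tens_eqv s t -> tens_eqv t s
| TE_trans s t u : tens_eqv s t -> tens_eqv t u -> tens_eqv s u
| TE_cat s s' t t' : tens_eqv s s' -> tens_eqv t t' ->
    tens_eqv (s ++ t) (s' ++ t')
| TE_catC s t : tens_eqv (s ++ t) (t ++ s)
| TE_0 n : tens_eqv [:: (0, n)] [::]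
| TE_Dl m m' n : tens_eqv [:: (m + m', n)] [:: (m, n); (m', n)]
| TE_Dr m n n' : tens_eqv [:: (m, n + n')] [:: (m, n); (m, n')]
| TE_Z r m n : tens_eqv [:: (r *: m, n)] [:: (m, r *: n)].

Let rel_ (s t : seq (M * N)) := `[< tens_eqv s t >].
Lemma tens_rel_refl : reflexive rel_.
Proof. by move=> s; apply/asboolP/TE_refl. Qed.
Lemma tens_rel_sym : symmetric rel_.
Proof. by move=> s t; apply/asboolP/asboolP => /TE_sym. Qed.
Lemma tens_rel_trans : transitive rel_.
Proof. by move=> t s u /asboolP st /asboolP tu; apply/asboolP/(TE_trans st). Qed.
Definition tens_rel := EquivRel rel_ tens_rel_refl tens_rel_sym tens_rel_trans.

Definition tens : Type := {eq_quot tens_rel}.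
HB.instance Definition _ := Choice.on tens.
HB.instance Definition _ := EqQuotient.on tens.

Definition tcls (s : seq (M * N)) : tens := \pi_tens s.

Lemma tens_eqP s t : tens_eqv s t <-> tcls s = tcls t.
Proof.
split=> [st|/eqP]; last by rewrite -[_ == _]/(_ == _ %[mod tens]) eqmodE => /asboolP.
by apply/eqP; rewrite -[_ == _]/(_ == _ %[mod tens]) eqmodE; apply/asboolP.
Qed.
Lemma tcls_repr t : tcls (repr t) = t.
Proof. exact: reprK. Qed.
Lemma tens_reprP s : tens_eqv (repr (tcls s)) s.
Proof. by apply/tens_eqP; rewrite tcls_repr. Qed.

Definition tpure (m : M) (n : N) : tens := tcls [:: (m, n)].

(* The map induced on the tensor product by a balanced biadditive f. *)
Definition tlift (V : zmodType) (f : M -> N -> V) (t : tens) : V :=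
  \sum_(p <- repr t) f p.1 p.2.

Definition tadd (s t : tens) : tens := tcls (repr s ++ repr t).
Definition topp (s : tens) : tens := tcls [seq (- p.1, p.2) | p <- repr s].
Definition tscale (r : R) (s : tens) : tens := tcls [seq (r *: p.1, p.2) | p <- repr s].

Lemma tens_eqv_map (f : M -> M) s t :
    f 0 = 0 -> {morph f : x y / x + y} -> (forall a x, f (a *: x) = a *: f x) ->
  tens_eqv s t ->
  tens_eqv [seq (f p.1, p.2) | p <- s] [seq (f p.1, p.2) | p <- t].
Proof.
move=> f0 fD fZ; elim => //=.
- by move=> *; exact: TE_refl.
- by move=> *; exact: TE_sym.
- by move=> s1 t1 u _ h1 _ h2; exact: TE_trans h1 h2.
- by move=> s1 s1' t1 t1' _ h1 _ h2; rewrite !map_cat; exact: TE_cat.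
- by move=> s1 t1; rewrite !map_cat; exact: TE_catC.
- by move=> n; rewrite f0; exact: TE_0.
- by move=> m m' n; rewrite fD; exact: TE_Dl.
- by move=> m n n'; exact: TE_Dr.
- by move=> r m n; rewrite fZ; exact: TE_Z.
Qed.

Lemma tadd_pi s t : tadd (tcls s) (tcls t) = tcls (s ++ t).
Proof. by apply/tens_eqP; apply: TE_cat; exact: tens_reprP. Qed.

Lemma tmap_pi (f : M -> M) s :
    f 0 = 0 -> {morph f : x y / x + y} -> (forall a x, f (a *: x) = a *: f x) ->
  tcls [seq (f p.1, p.2) | p <- repr (tcls s)]
  = tcls [seq (f p.1, p.2) | p <- s].
Proof. by move=> *; apply/tens_eqP/tens_eqv_map => //; exact: tens_reprP. Qed.

Lemma topp_pi s : topp (tcls s) = tcls [seq (- p.1, p.2) | p <- s].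
Proof.
by apply: tmap_pi; [rewrite oppr0 | exact: opprD | move=> *; rewrite scalerN].
Qed.

Lemma tscale_pi r s : tscale r (tcls s) = tcls [seq (r *: p.1, p.2) | p <- s].
Proof.
apply: tmap_pi; [exact: scaler0 | exact: scalerDr | move=> a x].
by rewrite !scalerA mulrC.
Qed.

Lemma tens_surj t : exists s, t = tcls s.
Proof. by exists (repr t); rewrite tcls_repr. Qed.

Fact tens_addA : associative tadd.
Proof.
move=> x y z; have [s ->] := tens_surj x; have [t ->] := tens_surj y.
have [u ->] := tens_surj z.
by rewrite (tadd_pi t u) (tadd_pi s t) (tadd_pi s) (tadd_pi (s ++ t)) catA.
Qed.
Fact tens_addC : commutative tadd.
Proof.
move=> x y; have [s ->] := tens_surj x; have [t ->] := tens_surj y.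
rewrite (tadd_pi s t) (tadd_pi t s).
by apply/tens_eqP/TE_catC.
Qed.
Fact tens_add0 : left_id (tcls [::]) tadd.
Proof. by move=> x; have [s ->] := tens_surj x; rewrite tadd_pi. Qed.
Fact tens_addN : left_inverse (tcls [::]) topp tadd.
Proof.
move=> x; have [s ->] := tens_surj x; elim: s => [|[m n] s IH].
  by rewrite (topp_pi [::]) (tadd_pi [::] [::]).
have -> : tcls ((m, n) :: s) = tadd (tcls [:: (m, n)]) (tcls s).
  by rewrite (tadd_pi [:: (m, n)]).
have -> : topp (tadd (tcls [:: (m, n)]) (tcls s))
    = tadd (tcls [:: (- m, n)]) (topp (tcls s)).
  by rewrite (tadd_pi [:: (m, n)]) !topp_pi (tadd_pi [:: (- m, n)]).
rewrite [tadd _ (topp _)]tens_addC -tens_addA [tadd (tcls [:: (- m, n)]) _]tens_addA.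
have -> : tadd (tcls [:: (- m, n)]) (tcls [:: (m, n)]) = tcls [::].
  rewrite (tadd_pi [:: (- m, n)]); apply/tens_eqP.
  by apply: TE_trans (TE_sym (TE_Dl _ _ _)) _; rewrite addNr; exact: TE_0.
by rewrite tens_add0.
Qed.

HB.instance Definition _ :=
  GRing.isZmodule.Build tens tens_addA tens_addC tens_add0 tens_addN.

Lemma tens_piE s : tcls s = \sum_(p <- s) tpure p.1 p.2.
Proof.
elim: s => [|[m n] s IH]; first by rewrite big_nil.
by rewrite big_cons -IH; apply: esym; exact: (tadd_pi [:: (m, n)] s).
Qed.

Lemma tpure_add m n m' n' :
  tpure m n + tpure m' n' = tcls [:: (m, n); (m', n')].
Proof. exact: (tadd_pi [:: _] [:: _]). Qed.

Fact tens_scaleA a b t : tscale a (tscale b t) = tscale (a * b) t.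
Proof.
have [s ->] := tens_surj t; rewrite !tscale_pi -map_comp.
by congr (tcls _); apply: eq_map => -[m n] /=; rewrite scalerA.
Qed.
Fact tens_scale1 : left_id 1 tscale.
Proof.
move=> x; have [s ->] := tens_surj x; rewrite tscale_pi -[s in RHS]map_id.
by congr (tcls _); apply: eq_map => -[m n] /=; rewrite scale1r.
Qed.
Fact tens_scaleDr : right_distributive tscale +%R.
Proof.
move=> a x y; have [s ->] := tens_surj x; have [t ->] := tens_surj y.
rewrite -[LHS]/(tscale a (tadd (tcls s) (tcls t))).
rewrite -[RHS]/(tadd (tscale a (tcls s)) (tscale a (tcls t))).
by rewrite (tadd_pi s t) !tscale_pi map_cat (tadd_pi [seq _ | _ <- s]).
Qed.
Fact tens_scaleDl t : {morph tscale^~ t : a b / a + b}.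
Proof.
move=> a b; have [s ->] := tens_surj t; rewrite !tscale_pi !tens_piE !big_map.
rewrite -big_split; apply: eq_bigr => -[m n] _ /=; rewrite scalerDl.
rewrite tpure_add.
by apply/tens_eqP/TE_Dl.
Qed.

HB.instance Definition _ := GRing.Zmodule_isLmodule.Build R tens
  tens_scaleA tens_scale1 tens_scaleDr tens_scaleDl.

Lemma tpureDl m m' n : tpure (m + m') n = tpure m n + tpure m' n.
Proof.
rewrite tpure_add; apply/tens_eqP; exact: TE_Dl.
Qed.
Lemma tpureDr m n n' : tpure m (n + n') = tpure m n + tpure m n'.
Proof.
rewrite tpure_add; apply/tens_eqP; exact: TE_Dr.
Qed.
Lemma tpureZl a m n : tpure (a *: m) n = a *: tpure m n.
Proof. exact: (esym (tscale_pi a [:: (m, n)])). Qed.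
Lemma tpureZr a m n : tpure m (a *: n) = a *: tpure m n.
Proof. by rewrite -tpureZl; apply/esym/tens_eqP/TE_Z. Qed.

Lemma tens_ind (P : tens -> Prop) :
  P 0 -> (forall s t, P s -> P t -> P (s + t)) -> (forall m n, P (tpure m n)) ->
  forall t, P t.
Proof.
by move=> P0 PD Pp t; have [s ->] := tens_surj t; rewrite tens_piE; apply: big_ind.
Qed.

Section Lift.
Variables (V : zmodType) (f : M -> N -> V).
Hypothesis fDl : forall m m' n, f (m + m') n = f m n + f m' n.
Hypothesis fDr : forall m n n', f m (n + n') = f m n + f m n'.
Hypothesis fZ : forall r m n, f (r *: m) n = f m (r *: n).

Lemma tens_eqv_lift s t : tens_eqv s t ->
  \sum_(p <- s) f p.1 p.2 = \sum_(p <- t) f p.1 p.2.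
Proof.
elim=> //=.
- by move=> s1 t1 u _ -> _ ->.
- by move=> s1 s1' t1 t1' _ e1 _ e2; rewrite !big_cat /= e1 e2.
- by move=> s1 t1; rewrite !big_cat /= addrC.
- move=> n; rewrite big_nil big_seq1 /=.
  by apply: (addrI (f 0 n)); rewrite -fDl !addr0.
- by move=> m m' n; rewrite big_seq1 /= fDl unlock /= addr0.
- by move=> m n n'; rewrite big_seq1 /= fDr unlock /= addr0.
- by move=> r m n; rewrite !big_seq1 /= fZ.
Qed.

Lemma tlift_pi s : tlift f (tcls s) = \sum_(p <- s) f p.1 p.2.
Proof. by apply: tens_eqv_lift; exact: tens_reprP. Qed.
Lemma tlift_pure m n : tlift f (tpure m n) = f m n.
Proof. by rewrite tlift_pi big_seq1. Qed.
Lemma tliftD : {morph tlift f : s t / s + t}.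
Proof.
move=> x y; have [s ->] := tens_surj x; have [t ->] := tens_surj y.
by rewrite -[_ + _]/(tadd (tcls s) (tcls t)) (tadd_pi s t) !tlift_pi big_cat.
Qed.
End Lift.

End Tensor.

Section TensorAlg.
Variables (R : comNzRingType) (A B : assocAlgType R).
Local Notation T := (tens A B).

Definition tens_mul (s t : T) : T :=
  tlift (fun a b => tlift (fun a' b' => tpure (amul a a') (amul b b')) t) s.
Definition tens_one : T := tpure aone aone.

Let inD1 (a : A) (b : B) (x x' : A) (y : B) :
  tpure (amul a (x + x')) (amul b y)
  = tpure (amul a x) (amul b y) + tpure (amul a x') (amul b y).
Proof. by rewrite amulDr tpureDl. Qed.
Let inD2 (a : A) (b : B) (x : A) (y y' : B) :
  tpure (amul a x) (amul b (y + y'))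
  = tpure (amul a x) (amul b y) + tpure (amul a x) (amul b y').
Proof. by rewrite amulDr tpureDr. Qed.
Let inZ (a : A) (b : B) r (x : A) (y : B) :
  tpure (amul a (r *: x)) (amul b y) = tpure (amul a x) (amul b (r *: y)).
Proof. by rewrite !amulZr tpureZl tpureZr. Qed.

Let in_pure a b a' b' :
  tlift (fun x y => tpure (amul a x) (amul b y)) (tpure a' b')
  = tpure (amul a a') (amul b b') :> T.
Proof. exact: tlift_pure (inD1 a b) (inD2 a b) (inZ a b) _ _. Qed.
Let in_D a b : {morph tlift (fun x y => tpure (amul a x) (amul b y) : T) :
  s t / s + t}.
Proof. exact: tliftD (inD1 a b) (inD2 a b) (inZ a b). Qed.
Let in_0 a b : tlift (fun x y => tpure (amul a x) (amul b y) : T) 0 = 0.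
Proof. by apply: (addrI (tlift (fun x y => tpure (amul a x) (amul b y)) 0));
  rewrite -in_D !addr0. Qed.

Let outD1 t (a a' : A) (b : B) :
  tlift (fun x y => tpure (amul (a + a') x) (amul b y)) t
  = tlift (fun x y => tpure (amul a x) (amul b y)) t
    + tlift (fun x y => tpure (amul a' x) (amul b y)) t :> T.
Proof.
elim/tens_ind: t => [|s t IHs IHt|x y]; first by rewrite !in_0 addr0.
  by rewrite !in_D IHs IHt addrACA.
by rewrite !in_pure amulDl tpureDl.
Qed.
Let outD2 t (a : A) (b b' : B) :
  tlift (fun x y => tpure (amul a x) (amul (b + b') y)) t
  = tlift (fun x y => tpure (amul a x) (amul b y)) t
    + tlift (fun x y => tpure (amul a x) (amul b' y)) t :> T.
Proof.
elim/tens_ind: t => [|s t IHs IHt|x y]; first by rewrite !in_0 addr0.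
  by rewrite !in_D IHs IHt addrACA.
by rewrite !in_pure amulDl tpureDr.
Qed.
Let outZ t r (a : A) (b : B) :
  tlift (fun x y => tpure (amul (r *: a) x) (amul b y)) t
  = tlift (fun x y => tpure (amul a x) (amul (r *: b) y)) t :> T.
Proof.
elim/tens_ind: t => [|s t IHs IHt|x y]; first by rewrite !in_0.
  by rewrite !in_D IHs IHt.
by rewrite !in_pure !amulZl tpureZl tpureZr.
Qed.

Lemma tens_mul_pure a b a' b' :
  tens_mul (tpure a b) (tpure a' b') = tpure (amul a a') (amul b b').
Proof.
rewrite /tens_mul (tlift_pure (outD1 _) (outD2 _) (outZ _)); exact: in_pure.
Qed.
Let mulDl : left_distributive tens_mul +%R.
Proof. by move=> s t u; exact: (tliftD (outD1 _) (outD2 _) (outZ _)). Qed.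
Let mul0 t : tens_mul 0 t = 0.
Proof. by apply: (addrI (tens_mul 0 t)); rewrite -mulDl !addr0. Qed.
Let pure_mul a b t :
  tens_mul (tpure a b) t = tlift (fun x y => tpure (amul a x) (amul b y)) t.
Proof. exact: (tlift_pure (outD1 t) (outD2 t) (outZ t)). Qed.
Let mulDr : right_distributive tens_mul +%R.
Proof.
move=> s t u; elim/tens_ind: s => [|s s' IH IH'|a b].
- by rewrite !mul0 addr0.
- by rewrite !mulDl IH IH' addrACA.
- by rewrite !pure_mul in_D.
Qed.
Let mulr0 t : tens_mul t 0 = 0.
Proof. by apply: (addrI (tens_mul t 0)); rewrite -mulDr !addr0. Qed.
Let mulZl r s t : tens_mul (r *: s) t = r *: tens_mul s t.
Proof.
elim/tens_ind: s => [|s s' IH IH'|a b]; first by rewrite scaler0 mul0 scaler0.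
  by rewrite scalerDr !mulDl IH IH' scalerDr.
elim/tens_ind: t => [|s s' IH IH'|a' b']; first by rewrite !mulr0 scaler0.
  by rewrite !mulDr IH IH' scalerDr.
by rewrite -tpureZl !tens_mul_pure amulZl tpureZl.
Qed.
Let mulZr r s t : tens_mul s (r *: t) = r *: tens_mul s t.
Proof.
elim/tens_ind: s => [|s s' IH IH'|a b]; first by rewrite !mul0 scaler0.
  by rewrite !mulDl IH IH' scalerDr.
elim/tens_ind: t => [|s s' IH IH'|a' b'].
- by rewrite scaler0 !mulr0 scaler0.
- by rewrite scalerDr !mulDr IH IH' scalerDr.
- by rewrite -tpureZl !tens_mul_pure amulZr tpureZl.
Qed.

Fact tens_mulA : associative tens_mul.
Proof.
move=> s t u; elim/tens_ind: s => [|s s' IH IH'|a b].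
- by rewrite !mul0.
- by rewrite !mulDl IH IH'.
elim/tens_ind: t => [|s s' IH IH'|a' b'].
- by rewrite !mul0 !mulr0 mul0.
- by rewrite mulDl !mulDr mulDl IH IH'.
elim/tens_ind: u => [|s s' IH IH'|a'' b'']; first by rewrite !mulr0.
  by rewrite !mulDr IH IH'.
by rewrite !tens_mul_pure !amulA.
Qed.
Fact tens_mul1l : left_id tens_one tens_mul.
Proof.
elim/tens_ind => [|s s' IH IH'|a b]; rewrite ?mulr0 ?mulDr ?IH ?IH' //.
by rewrite tens_mul_pure !amul1l.
Qed.
Fact tens_mul1r : right_id tens_one tens_mul.
Proof.
elim/tens_ind => [|s s' IH IH'|a b]; rewrite ?mul0 ?mulDl ?IH ?IH' //.
by rewrite tens_mul_pure !amul1r.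
Qed.
Fact tens_mul_linearl t a u v :
  tens_mul (a *: u + v) t = a *: tens_mul u t + tens_mul v t.
Proof. by rewrite mulDl mulZl. Qed.
Fact tens_mul_linearr t a u v :
  tens_mul t (a *: u + v) = a *: tens_mul t u + tens_mul t v.
Proof. by rewrite mulDr mulZr. Qed.

HB.instance Definition _ := isAssocAlg.Build R (tens A B) tens_mulA tens_mul1l
  tens_mul1r tens_mul_linearl tens_mul_linearr.

End TensorAlg.

Record subgroup_of (V : zmodType) := Subgroup {
  sg_mem :> V -> Prop;
  sg_0 : sg_mem 0;
  sg_B : forall x y, sg_mem x -> sg_mem y -> sg_mem (x - y) }.

Section Quotient.
Variables (V : zmodType) (I : subgroup_of V).

Lemma sg_N x : I x -> I (- x).
Proof. by move=> Ix; rewrite -sub0r; apply: sg_B => //; exact: sg_0. Qed.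
Lemma sg_D x y : I x -> I y -> I (x + y).
Proof. by move=> Ix Iy; rewrite -[y]opprK; apply/sg_B/sg_N. Qed.

Let rel_ (x y : V) := `[< I (x - y) >].
Lemma quot_rel_refl : reflexive rel_.
Proof. by move=> x; apply/asboolP; rewrite subrr; exact: sg_0. Qed.
Lemma quot_rel_sym : symmetric rel_.
Proof. by move=> x y; apply/asboolP/asboolP => /sg_N; rewrite opprB. Qed.
Lemma quot_rel_trans : transitive rel_.
Proof.
move=> y x t /asboolP xy /asboolP yt; apply/asboolP.
by rewrite -(subrK y x) -addrA; exact: sg_D.
Qed.
Definition quot_rel := EquivRel rel_ quot_rel_refl quot_rel_sym quot_rel_trans.

Definition quot : Type := {eq_quot quot_rel}.
HB.instance Definition _ := Choice.on quot.
HB.instance Definition _ := EqQuotient.on quot.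

Definition qcls (x : V) : quot := \pi_quot x.

Lemma qclsP x y : I (x - y) <-> qcls x = qcls y.
Proof.
split=> [st|/eqP]; last by
  rewrite -[_ == _]/(_ == _ %[mod quot]) eqmodE => /asboolP.
by apply/eqP; rewrite -[_ == _]/(_ == _ %[mod quot]) eqmodE; apply/asboolP.
Qed.
Lemma qcls_repr t : qcls (repr t) = t.
Proof. exact: reprK. Qed.
Lemma qcls_surj t : exists x, t = qcls x.
Proof. by exists (repr t); rewrite qcls_repr. Qed.
Lemma qreprP x : I (repr (qcls x) - x).
Proof. by apply/qclsP; rewrite qcls_repr. Qed.

Definition quot_add (s t : quot) : quot := qcls (repr s + repr t).
Definition quot_opp (s : quot) : quot := qcls (- repr s).

Lemma quot_add_cls x y : quot_add (qcls x) (qcls y) = qcls (x + y).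
Proof. by apply/qclsP; rewrite opprD addrACA; apply: sg_D; exact: qreprP. Qed.
Lemma quot_opp_cls x : quot_opp (qcls x) = qcls (- x).
Proof. by apply/qclsP; rewrite opprK addrC -opprB; apply/sg_N/qreprP. Qed.

Fact quot_addA : associative quot_add.
Proof.
move=> s t u; have [x ->] := qcls_surj s; have [y ->] := qcls_surj t.
have [z ->] := qcls_surj u.
rewrite (quot_add_cls y z) (quot_add_cls x y) (quot_add_cls x).
by rewrite (quot_add_cls (x + y)) addrA.
Qed.
Fact quot_addC : commutative quot_add.
Proof. by move=> s t; rewrite /quot_add addrC. Qed.
Fact quot_add0 : left_id (qcls 0) quot_add.
Proof. by move=> s; have [x ->] := qcls_surj s; rewrite quot_add_cls add0r. Qed.
Fact quot_addN : left_inverse (qcls 0) quot_opp quot_add.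
Proof.
move=> s; have [x ->] := qcls_surj s.
by rewrite quot_opp_cls (quot_add_cls (- x)) addNr.
Qed.

HB.instance Definition _ :=
  GRing.isZmodule.Build quot quot_addA quot_addC quot_add0 quot_addN.

Lemma qclsD x y : qcls (x + y) = qcls x + qcls y.
Proof. exact: (esym (quot_add_cls x y)). Qed.
Lemma qclsN x : qcls (- x) = - qcls x.
Proof. exact: (esym (quot_opp_cls x)). Qed.
Lemma qcls0 : qcls 0 = 0.
Proof. by []. Qed.
Lemma qclsB x y : qcls (x - y) = qcls x - qcls y.
Proof. by rewrite qclsD qclsN. Qed.

End Quotient.

(* The tensor algebra, presented as the R-algebra generated by M subject to   *)
(* the R-linearity of the generators.                                         *)
Section TensorAlgebra.
Variables (R : comNzRingType) (M : lmodType R).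

Inductive tterm :=
| TScal of R | TGen of M | TAdd of tterm & tterm | TMul of tterm & tterm.

HB.instance Definition _ := gen_eqMixin tterm.
HB.instance Definition _ := gen_choiceMixin tterm.

Inductive tterm_eqv : tterm -> tterm -> Prop :=
| TT_refl x : tterm_eqv x x
| TT_sym x y : tterm_eqv x y -> tterm_eqv y x
| TT_trans x y u : tterm_eqv x y -> tterm_eqv y u -> tterm_eqv x u
| TT_add x x' y y' : tterm_eqv x x' -> tterm_eqv y y' ->
    tterm_eqv (TAdd x y) (TAdd x' y')
| TT_mul x x' y y' : tterm_eqv x x' -> tterm_eqv y y' ->
    tterm_eqv (TMul x y) (TMul x' y')
| TT_addA x y u : tterm_eqv (TAdd x (TAdd y u)) (TAdd (TAdd x y) u)
| TT_addC x y : tterm_eqv (TAdd x y) (TAdd y x)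
| TT_add0 x : tterm_eqv (TAdd (TScal 0) x) x
| TT_mul0 x : tterm_eqv (TMul (TScal 0) x) (TScal 0)
| TT_mulA x y u : tterm_eqv (TMul x (TMul y u)) (TMul (TMul x y) u)
| TT_mul1 x : tterm_eqv (TMul (TScal 1) x) x
| TT_mulDl x y u : tterm_eqv (TMul (TAdd x y) u) (TAdd (TMul x u) (TMul y u))
| TT_mulDr x y u : tterm_eqv (TMul u (TAdd x y)) (TAdd (TMul u x) (TMul u y))
| TT_scalC r x : tterm_eqv (TMul (TScal r) x) (TMul x (TScal r))
| TT_scalD r s : tterm_eqv (TScal (r + s)) (TAdd (TScal r) (TScal s))
| TT_scalM r s : tterm_eqv (TScal (r * s)) (TMul (TScal r) (TScal s))
| TT_genD m n : tterm_eqv (TGen (m + n)) (TAdd (TGen m) (TGen n))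
| TT_genZ r m : tterm_eqv (TGen (r *: m)) (TMul (TScal r) (TGen m)).

Let rel_ (x y : tterm) := `[< tterm_eqv x y >].
Lemma tterm_rel_refl : reflexive rel_.
Proof. by move=> s; apply/asboolP/TT_refl. Qed.
Lemma tterm_rel_sym : symmetric rel_.
Proof. by move=> s t; apply/asboolP/asboolP => /TT_sym. Qed.
Lemma tterm_rel_trans : transitive rel_.
Proof. by move=> t s u /asboolP st /asboolP tu; apply/asboolP/(TT_trans st). Qed.
Definition tterm_rel :=
  EquivRel rel_ tterm_rel_refl tterm_rel_sym tterm_rel_trans.

Definition talg : Type := {eq_quot tterm_rel}.
HB.instance Definition _ := Choice.on talg.
HB.instance Definition _ := EqQuotient.on talg.

Definition tacls (x : tterm) : talg := \pi_talg x.

Lemma taclsP x y : tterm_eqv x y <-> tacls x = tacls y.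
Proof.
split=> [st|/eqP]; last by
  rewrite -[_ == _]/(_ == _ %[mod talg]) eqmodE => /asboolP.
by apply/eqP; rewrite -[_ == _]/(_ == _ %[mod talg]) eqmodE; apply/asboolP.
Qed.
Lemma tacls_repr t : tacls (repr t) = t.
Proof. exact: reprK. Qed.
Lemma tacls_surj t : exists x, t = tacls x.
Proof. by exists (repr t); rewrite tacls_repr. Qed.
Lemma tareprP x : tterm_eqv (repr (tacls x)) x.
Proof. by apply/taclsP; rewrite tacls_repr. Qed.

Definition talg_gen (m : M) : talg := tacls (TGen m).
Definition talg_add (s t : talg) : talg := tacls (TAdd (repr s) (repr t)).
Definition talg_mul (s t : talg) : talg := tacls (TMul (repr s) (repr t)).
Definition talg_scale (r : R) (s : talg) : talg := tacls (TMul (TScal r) (repr s)).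
Definition talg_opp (s : talg) : talg := talg_scale (-1) s.

Lemma talg_addE x y : talg_add (tacls x) (tacls y) = tacls (TAdd x y).
Proof. by apply/taclsP/TT_add; exact: tareprP. Qed.
Lemma talg_mulE x y : talg_mul (tacls x) (tacls y) = tacls (TMul x y).
Proof. by apply/taclsP/TT_mul; exact: tareprP. Qed.
Lemma talg_scaleE r x : talg_scale r (tacls x) = tacls (TMul (TScal r) x).
Proof. by apply/taclsP/TT_mul; [exact: TT_refl | exact: tareprP]. Qed.

Fact talg_addA : associative talg_add.
Proof.
move=> s t u; have [x ->] := tacls_surj s; have [y ->] := tacls_surj t.
have [z ->] := tacls_surj u.
rewrite (talg_addE y z) (talg_addE x y) (talg_addE x) (talg_addE (TAdd x y)).
exact/taclsP/TT_addA.
Qed.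
Fact talg_addC : commutative talg_add.
Proof. by move=> s t; apply/taclsP/TT_addC. Qed.
Fact talg_add0 : left_id (tacls (TScal 0)) talg_add.
Proof.
move=> s; have [x ->] := tacls_surj s; rewrite talg_addE.
exact/taclsP/TT_add0.
Qed.
Fact talg_addN : left_inverse (tacls (TScal 0)) talg_opp talg_add.
Proof.
move=> s; have [x ->] := tacls_surj s; rewrite /talg_opp talg_scaleE.
rewrite (talg_addE (TMul _ _)); apply/taclsP.
apply: TT_trans (TT_add (TT_refl _) (TT_sym (TT_mul1 _))) _.
apply: TT_trans (TT_sym (TT_mulDl _ _ _)) _.
apply: TT_trans (TT_mul (TT_sym (TT_scalD _ _)) (TT_refl _)) _.
by rewrite addNr; exact: TT_mul0.
Qed.

HB.instance Definition _ :=
  GRing.isZmodule.Build talg talg_addA talg_addC talg_add0 talg_addN.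

Lemma taclsD x y : tacls (TAdd x y) = tacls x + tacls y.
Proof. exact: (esym (talg_addE x y)). Qed.

Fact talg_scaleA a b t : talg_scale a (talg_scale b t) = talg_scale (a * b) t.
Proof.
have [x ->] := tacls_surj t; rewrite (talg_scaleE b) (talg_scaleE a).
rewrite talg_scaleE; apply/taclsP; apply: TT_trans (TT_mulA _ _ _) _.
by apply: TT_mul (TT_refl _); exact/TT_sym/TT_scalM.
Qed.
Fact talg_scale1 : left_id 1 talg_scale.
Proof.
move=> t; have [x ->] := tacls_surj t; rewrite talg_scaleE.
exact/taclsP/TT_mul1.
Qed.
Fact talg_scaleDr : right_distributive talg_scale +%R.
Proof.
move=> a s t; have [x ->] := tacls_surj s; have [y ->] := tacls_surj t.
rewrite -taclsD !talg_scaleE -taclsD; exact/taclsP/TT_mulDr.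
Qed.
Fact talg_scaleDl t : {morph talg_scale^~ t : a b / a + b}.
Proof.
move=> a b; have [x ->] := tacls_surj t; rewrite !talg_scaleE -taclsD.
apply/taclsP; apply: TT_trans (TT_mul (TT_scalD _ _) (TT_refl _)) _.
exact: TT_mulDl.
Qed.

HB.instance Definition _ := GRing.Zmodule_isLmodule.Build R talg
  talg_scaleA talg_scale1 talg_scaleDr talg_scaleDl.

Lemma taclsZ r x : tacls (TMul (TScal r) x) = r *: tacls x.
Proof. exact: (esym (talg_scaleE r x)). Qed.

Fact talg_mulA : associative talg_mul.
Proof.
move=> s t u; have [x ->] := tacls_surj s; have [y ->] := tacls_surj t.
have [z ->] := tacls_surj u.
rewrite (talg_mulE y z) (talg_mulE x y) (talg_mulE x) (talg_mulE (TMul x y)).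
exact/taclsP/TT_mulA.
Qed.
Fact talg_mul1l : left_id (tacls (TScal 1)) talg_mul.
Proof.
move=> t; have [x ->] := tacls_surj t; rewrite talg_mulE.
exact/taclsP/TT_mul1.
Qed.
Fact talg_mul1r : right_id (tacls (TScal 1)) talg_mul.
Proof.
move=> t; have [x ->] := tacls_surj t; rewrite talg_mulE; apply/taclsP.
by apply: TT_trans (TT_sym (TT_scalC _ _)) _; exact: TT_mul1.
Qed.
Fact talg_mul_linearl t a u v :
  talg_mul (a *: u + v) t = a *: talg_mul u t + talg_mul v t.
Proof.
have [x ->] := tacls_surj u; have [y ->] := tacls_surj v.
have [z ->] := tacls_surj t; rewrite -taclsZ -taclsD !talg_mulE -taclsZ -taclsD.
apply/taclsP; apply: TT_trans (TT_mulDl _ _ _) _.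
by apply: TT_add (TT_refl _); exact/TT_sym/TT_mulA.
Qed.
Fact talg_mul_linearr t a u v :
  talg_mul t (a *: u + v) = a *: talg_mul t u + talg_mul t v.
Proof.
have [x ->] := tacls_surj u; have [y ->] := tacls_surj v.
have [z ->] := tacls_surj t; rewrite -taclsZ -taclsD !talg_mulE -taclsZ -taclsD.
apply/taclsP; apply: TT_trans (TT_mulDr _ _ _) _.
apply: TT_add (TT_refl _); apply: TT_trans (TT_mulA _ _ _) _.
apply: TT_trans (TT_mul (TT_sym (TT_scalC _ _)) (TT_refl _)) _.
exact/TT_sym/TT_mulA.
Qed.

HB.instance Definition _ := isAssocAlg.Build R talg talg_mulA talg_mul1l
  talg_mul1r talg_mul_linearl talg_mul_linearr.

(* The ring map on the tensor algebra induced by f : M -> A, extending the    *)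
(* map s on scalars; s allows A to be an algebra over another base ring.      *)
Section Lift.
Variables (K : comNzRingType) (A : assocAlgType K) (s : R -> A) (f : M -> A).

Fixpoint tterm_eval (x : tterm) : A :=
  match x with
  | TScal r => s r
  | TGen m => f m
  | TAdd x y => tterm_eval x + tterm_eval y
  | TMul x y => amul (tterm_eval x) (tterm_eval y)
  end.

Definition talg_lift (t : talg) : A := tterm_eval (repr t).

Hypothesis s0 : s 0 = 0.
Hypothesis s1 : s 1 = aone.
Hypothesis sD : {morph s : x y / x + y}.
Hypothesis sM : forall x y, s (x * y) = amul (s x) (s y).
Hypothesis sC : forall r a, amul (s r) a = amul a (s r).
Hypothesis fD : {morph f : x y / x + y}.
Hypothesis fZ : forall r m, f (r *: m) = amul (s r) (f m).

Lemma tterm_eval_eqv x y : tterm_eqv x y -> tterm_eval x = tterm_eval y.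
Proof.
elim=> //= *; try congruence.
- exact: addrA.
- exact: addrC.
- by rewrite s0 add0r.
- by rewrite s0 amul0x.
- exact: amulA.
- by rewrite s1 amul1l.
- exact: amulDl.
- exact: amulDr.
Qed.
Lemma talg_lift_cls x : talg_lift (tacls x) = tterm_eval x.
Proof. exact/tterm_eval_eqv/tareprP. Qed.

End Lift.

End TensorAlgebra.

Section QuotientAlgebra.
Variables (R : comNzRingType) (A : assocAlgType R) (S : A -> Prop).

(* The two-sided ideal generated by S. *)
Inductive ideal_gen : A -> Prop :=
| IG_gen x : S x -> ideal_gen x
| IG_0 : ideal_gen 0
| IG_B x y : ideal_gen x -> ideal_gen y -> ideal_gen (x - y)
| IG_mull a x : ideal_gen x -> ideal_gen (amul a x)
| IG_mulr a x : ideal_gen x -> ideal_gen (amul x a).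

Definition ideal_sub := Subgroup IG_0 IG_B.
Definition alg_quot : Type := quot ideal_sub.
HB.instance Definition _ := GRing.Zmodule.on alg_quot.

Definition acls (x : A) : alg_quot := qcls ideal_sub x.

Lemma aclsP x y : ideal_gen (x - y) <-> acls x = acls y.
Proof. exact: (qclsP ideal_sub). Qed.
Lemma acls_repr (t : alg_quot) : acls (repr t) = t.
Proof. exact: (@qcls_repr _ ideal_sub). Qed.
Lemma areprP x : ideal_gen (repr (acls x) - x).
Proof. exact: (qreprP ideal_sub). Qed.
Lemma acls_surj (t : alg_quot) : exists x, t = acls x.
Proof. by exists (repr t); rewrite acls_repr. Qed.
Lemma aclsD x y : acls (x + y) = acls x + acls y.
Proof. exact: (qclsD ideal_sub). Qed.

Lemma IG_Z r x : ideal_gen x -> ideal_gen (r *: x).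
Proof. by move=> Ix; rewrite -[x]amul1l -amulZl; exact: IG_mull. Qed.

Definition aquot_scale (r : R) (t : alg_quot) : alg_quot := acls (r *: repr t).
Definition aquot_mul (s t : alg_quot) : alg_quot := acls (amul (repr s) (repr t)).

Lemma aquot_scaleE r x : aquot_scale r (acls x) = acls (r *: x).
Proof. by apply/aclsP; rewrite -scalerBr; apply/IG_Z/areprP. Qed.
Lemma aquot_mulE x y : aquot_mul (acls x) (acls y) = acls (amul x y).
Proof.
apply/aclsP; set x' := repr _; set y' := repr _.
have -> : amul x' y' - amul x y = amul (x' - x) y' - amul x (y - y').
  by rewrite amulBl amulBr opprB addrA subrK.
apply: IG_B; first exact/IG_mulr/areprP.
by apply: IG_mull; rewrite -opprB -sub0r; apply: IG_B IG_0 (areprP _).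
Qed.

Fact aquot_scaleA a b t : aquot_scale a (aquot_scale b t) = aquot_scale (a * b) t.
Proof. by have [x ->] := acls_surj t; rewrite !aquot_scaleE scalerA. Qed.
Fact aquot_scale1 : left_id 1 aquot_scale.
Proof. by move=> t; have [x ->] := acls_surj t; rewrite aquot_scaleE scale1r. Qed.
Fact aquot_scaleDr : right_distributive aquot_scale +%R.
Proof.
move=> a s t; have [x ->] := acls_surj s; have [y ->] := acls_surj t.
by rewrite -aclsD !aquot_scaleE -aclsD scalerDr.
Qed.
Fact aquot_scaleDl t : {morph aquot_scale^~ t : a b / a + b}.
Proof.
move=> a b; have [x ->] := acls_surj t.
by rewrite !aquot_scaleE -aclsD scalerDl.
Qed.
HB.instance Definition _ := GRing.Zmodule_isLmodule.Build R alg_quot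
  aquot_scaleA aquot_scale1 aquot_scaleDr aquot_scaleDl.

Lemma aclsZ r x : acls (r *: x) = r *: acls x.
Proof. exact: (esym (aquot_scaleE r x)). Qed.

Fact aquot_mulA : associative aquot_mul.
Proof.
move=> s t u; have [x ->] := acls_surj s; have [y ->] := acls_surj t.
have [z ->] := acls_surj u; by rewrite !aquot_mulE amulA.
Qed.
Fact aquot_mul1l : left_id (acls aone) aquot_mul.
Proof. by move=> t; have [x ->] := acls_surj t; rewrite aquot_mulE amul1l. Qed.
Fact aquot_mul1r : right_id (acls aone) aquot_mul.
Proof. by move=> t; have [x ->] := acls_surj t; rewrite aquot_mulE amul1r. Qed.
Fact aquot_mul_linearl t a u v :
  aquot_mul (a *: u + v) t = a *: aquot_mul u t + aquot_mul v t.
Proof.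
have [x ->] := acls_surj u; have [y ->] := acls_surj v.
have [z ->] := acls_surj t.
by rewrite -aclsZ -aclsD !aquot_mulE -aclsZ -aclsD amul_linearl.
Qed.
Fact aquot_mul_linearr t a u v :
  aquot_mul t (a *: u + v) = a *: aquot_mul t u + aquot_mul t v.
Proof.
have [x ->] := acls_surj u; have [y ->] := acls_surj v.
have [z ->] := acls_surj t.
by rewrite -aclsZ -aclsD !aquot_mulE -aclsZ -aclsD amul_linearr.
Qed.
HB.instance Definition _ := isAssocAlg.Build R alg_quot aquot_mulA aquot_mul1l
  aquot_mul1r aquot_mul_linearl aquot_mul_linearr.

End QuotientAlgebra.

Section Enveloping.
Variables (R : comNzRingType) (L : lieAlgType R).

Inductive uenv_rel : talg L -> Prop :=
| UenvRel x y : uenv_rel (amul (talg_gen x) (talg_gen y)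
    - amul (talg_gen y) (talg_gen x) - talg_gen (lie x y)).

Definition uenv : Type := alg_quot uenv_rel.
HB.instance Definition _ := AssocAlg.on uenv.

Definition uenv_gen (x : L) : uenv := acls uenv_rel (talg_gen x).

Definition uenv_lift (K : comNzRingType) (A : assocAlgType K) (s : R -> A)
    (f : L -> A) (t : uenv) : A :=
  talg_lift s f (repr t).

End Enveloping.

Section Clifford.
Variables (R : comNzRingType) (M : lmodType R) (B : M -> M -> R).

Inductive cliff_rel : talg M -> Prop :=
| CliffRel x y : cliff_rel (amul (talg_gen x) (talg_gen y)
    + amul (talg_gen y) (talg_gen x) - B x y *: aone).

Definition cliff : Type := alg_quot cliff_rel.
HB.instance Definition _ := AssocAlg.on cliff.

Definition cliff_gen (x : M) : cliff := acls cliff_rel (talg_gen x).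

Definition cliff_lift (K : comNzRingType) (A : assocAlgType K) (s : R -> A)
    (f : M -> A) (t : cliff) : A :=
  talg_lift s f (repr t).

End Clifford.

Section FunctorialMaps.
Variable R : comNzRingType.

Definition uenv_map (L L' : lieAlgType R) (f : L -> L') : uenv L -> uenv L' :=
  uenv_lift (fun r => r *: aone) (fun x => uenv_gen (f x)).

Definition cliff_map (M M' : lmodType R) (B : M -> M -> R) (B' : M' -> M' -> R)
    (f : M -> M') : cliff B -> cliff B' :=
  cliff_lift (fun r => r *: aone) (fun x => cliff_gen B' (f x)).

Definition tens_map (M N M' N' : lmodType R) (f : M -> M') (g : N -> N') :
    tens M N -> tens M' N' :=
  tlift (fun x y => tpure (f x) (g y)).

End FunctorialMaps.

Section ZeroFiber.
Variables (F : comNzRingType) (M : lmodType {poly F}).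

Definition zmul_mem (x : M) : Prop := exists y, x = 'X *: y.
Fact zmul_0 : zmul_mem 0. Proof. by exists 0; rewrite scaler0. Qed.
Fact zmul_B x y : zmul_mem x -> zmul_mem y -> zmul_mem (x - y).
Proof. by move=> [u ->] [v ->]; exists (u - v); rewrite scalerBr. Qed.
Definition zmul_sub := Subgroup zmul_0 zmul_B.

(* The zero fiber M / zM, as an F-module. *)
Definition zfib : Type := quot zmul_sub.
HB.instance Definition _ := GRing.Zmodule.on zfib.

Definition zcls (x : M) : zfib := qcls zmul_sub x.

Lemma zclsP x y : zmul_mem (x - y) <-> zcls x = zcls y.
Proof. exact: (qclsP zmul_sub). Qed.
Lemma zcls_repr (t : zfib) : zcls (repr t) = t.
Proof. exact: (@qcls_repr _ zmul_sub). Qed.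
Lemma zreprP x : zmul_mem (repr (zcls x) - x).
Proof. exact: (qreprP zmul_sub). Qed.
Lemma zcls_surj (t : zfib) : exists x, t = zcls x.
Proof. by exists (repr t); rewrite zcls_repr. Qed.
Lemma zclsD x y : zcls (x + y) = zcls x + zcls y.
Proof. exact: (qclsD zmul_sub). Qed.

Definition zfib_scale (c : F) (t : zfib) : zfib := zcls (c%:P *: repr t).
Lemma zfib_scaleE c x : zfib_scale c (zcls x) = zcls (c%:P *: x).
Proof.
apply/zclsP; rewrite -scalerBr; have [y ->] := zreprP x.
by exists (c%:P *: y); rewrite !scalerA mulrC.
Qed.
Fact zfib_scaleA a b t : zfib_scale a (zfib_scale b t) = zfib_scale (a * b) t.
Proof.
by have [x ->] := zcls_surj t; rewrite !zfib_scaleE scalerA polyCM.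
Qed.
Fact zfib_scale1 : left_id 1 zfib_scale.
Proof. by move=> t; have [x ->] := zcls_surj t; rewrite zfib_scaleE scale1r. Qed.
Fact zfib_scaleDr : right_distributive zfib_scale +%R.
Proof.
move=> a s t; have [x ->] := zcls_surj s; have [y ->] := zcls_surj t.
by rewrite -zclsD !zfib_scaleE -zclsD scalerDr.
Qed.
Fact zfib_scaleDl t : {morph zfib_scale^~ t : a b / a + b}.
Proof.
move=> a b; have [x ->] := zcls_surj t.
by rewrite !zfib_scaleE -zclsD polyCD scalerDl.
Qed.
HB.instance Definition _ := GRing.Zmodule_isLmodule.Build F zfib
  zfib_scaleA zfib_scale1 zfib_scaleDr zfib_scaleDl.

Lemma zclsZ c x : zcls (c%:P *: x) = c *: zcls x.
Proof. exact: (esym (zfib_scaleE c x)). Qed.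

End ZeroFiber.

Section ZeroFiberAlg.
Variables (F : comNzRingType) (A : assocAlgType {poly F}).
Local Notation zA := (zfib A).

Definition zfib_mul (s t : zA) : zA := zcls (amul (repr s) (repr t)).
Lemma zfib_mulE (x y : A) : zfib_mul (zcls x) (zcls y) = zcls (amul x y).
Proof.
apply/zclsP; have [u hu] := zreprP x; have [v hv] := zreprP y.
exists (amul u (repr (zcls y)) + amul x v).
rewrite scalerDr -amulZl -amulZr -hu -hv amulBl amulBr.
by rewrite addrA subrK.
Qed.
Fact zfib_mulA : associative zfib_mul.
Proof.
move=> s t u; have [x ->] := zcls_surj s; have [y ->] := zcls_surj t.
have [z ->] := zcls_surj u; rewrite (zfib_mulE y z) (zfib_mulE x y).
by rewrite (zfib_mulE x) (zfib_mulE (amul x y)) amulA.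
Qed.
Fact zfib_mul1l : left_id (zcls aone) zfib_mul.
Proof. by move=> t; have [x ->] := zcls_surj t; rewrite zfib_mulE amul1l. Qed.
Fact zfib_mul1r : right_id (zcls aone) zfib_mul.
Proof. by move=> t; have [x ->] := zcls_surj t; rewrite zfib_mulE amul1r. Qed.
Fact zfib_mul_linearl t a u v :
  zfib_mul (a *: u + v) t = a *: zfib_mul u t + zfib_mul v t.
Proof.
have [x ->] := zcls_surj u; have [y ->] := zcls_surj v.
have [z ->] := zcls_surj t.
by rewrite -zclsZ -zclsD !zfib_mulE -zclsZ -zclsD amul_linearl.
Qed.
Fact zfib_mul_linearr t a u v :
  zfib_mul t (a *: u + v) = a *: zfib_mul t u + zfib_mul t v.
Proof.
have [x ->] := zcls_surj u; have [y ->] := zcls_surj v.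
have [z ->] := zcls_surj t.
by rewrite -zclsZ -zclsD !zfib_mulE -zclsZ -zclsD amul_linearr.
Qed.
HB.instance Definition _ := isAssocAlg.Build F (zfib A) zfib_mulA zfib_mul1l
  zfib_mul1r zfib_mul_linearl zfib_mul_linearr.

End ZeroFiberAlg.

Section ZeroFiberLie.
Variables (F : comNzRingType) (L : lieAlgType {poly F}).
Local Notation zL := (zfib L).

Definition zfib_lie (s t : zL) : zL := zcls (lie (repr s) (repr t)).
Lemma zfib_lieE (x y : L) : zfib_lie (zcls x) (zcls y) = zcls (lie x y).
Proof.
apply/zclsP; have [u hu] := zreprP x; have [v hv] := zreprP y.
exists (lie u (repr (zcls y)) + lie x v).
rewrite scalerDr -lieZl -lieZr -hu -hv lieDl lieDr lieNl lieNr.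
by rewrite addrA subrK.
Qed.
Fact zfib_lie_linearl t a u v :
  zfib_lie (a *: u + v) t = a *: zfib_lie u t + zfib_lie v t.
Proof.
have [x ->] := zcls_surj u; have [y ->] := zcls_surj v.
have [z ->] := zcls_surj t.
by rewrite -zclsZ -zclsD !zfib_lieE -zclsZ -zclsD lie_linearl.
Qed.
Fact zfib_lie_linearr t a u v :
  zfib_lie t (a *: u + v) = a *: zfib_lie t u + zfib_lie t v.
Proof.
have [x ->] := zcls_surj u; have [y ->] := zcls_surj v.
have [z ->] := zcls_surj t.
by rewrite -zclsZ -zclsD !zfib_lieE -zclsZ -zclsD lie_linearr.
Qed.
Fact zfib_liexx t : zfib_lie t t = 0.
Proof. by have [x ->] := zcls_surj t; rewrite zfib_lieE liexx. Qed.
Fact zfib_jacobi s t u : zfib_lie s (zfib_lie t u) + zfib_lie t (zfib_lie u s)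
  + zfib_lie u (zfib_lie s t) = 0.
Proof.
have [x ->] := zcls_surj s; have [y ->] := zcls_surj t.
have [z ->] := zcls_surj u.
rewrite (zfib_lieE y z) (zfib_lieE z x) (zfib_lieE x y).
by rewrite (zfib_lieE x) (zfib_lieE y) (zfib_lieE z) -(zclsD (lie x _)) -(zclsD (_ + _)) lie_jacobi.
Qed.
HB.instance Definition _ := isLie.Build F (zfib L) zfib_lie_linearl
  zfib_lie_linearr zfib_liexx zfib_jacobi.

End ZeroFiberLie.

Section BaseChange.
Variable F : comNzRingType.

Definition uenv_base_change (L : lieAlgType {poly F}) :
    uenv (zfib L) -> zfib (uenv L) :=
  uenv_lift (fun c => c *: aone) (fun x : zfib L => zcls (uenv_gen (repr x))).

(* The form induced on the zero fiber, with values in F[z]/(z) = F. *)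
Definition zfib_form (M : lmodType {poly F}) (B : M -> M -> {poly F})
  (x y : zfib M) : F := (B (repr x) (repr y)).[0].

Definition cliff_base_change (M : lmodType {poly F}) (B : M -> M -> {poly F}) :
    cliff (zfib_form B) -> zfib (cliff B) :=
  cliff_lift (fun c => c *: aone) (fun x : zfib M => zcls (cliff_gen B (repr x))).

(* The canonical map (M (x) N)|_0 -> M|_0 (x) N|_0. *)
Definition zfib_tens (M N : lmodType {poly F}) (t : zfib (tens M N)) :
    tens (zfib M) (zfib N) :=
  tlift (fun x y => tpure (zcls x) (zcls y)) (repr t).

End BaseChange.

(* The inverse of a bijection f between modules. *)
Definition inverse_map (X Y : zmodType) (f : X -> Y) (y : Y) : X :=
  xget 0 [set x | f x = y].

HB.instance Definition _ (R : comNzRingType) (g : symLieType R) :=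
  GRing.isLinear.Build R g g _ (@theta R g) (@theta_linear R g).

Section ThetaTheory.
Variables (R : comNzRingType) (g : symLieType R).
Implicit Types x y : g.
Lemma thetaD x y : theta (x + y) = theta x + theta y. Proof. exact: linearD. Qed.
Lemma thetaN x : theta (- x) = - theta x. Proof. exact: linearN. Qed.
Lemma thetaZ a x : theta (a *: x) = a *: theta x. Proof. exact: linearZ. Qed.
End ThetaTheory.

Section CartanDecomposition.
Variables (F : numFieldType) (g : symLieType F).
Implicit Types x y : g.

Definition kproj x : g := 2^-1 *: (x + theta x).
Definition pproj x : g := 2^-1 *: (x - theta x).

Definition pspace : {vspace g} := lker (linfun (@theta F g) + \1)%VF.

Lemma memp x : (x \in pspace) = (theta x == - x).
Proof. by rewrite memv_ker add_lfunE lfunE id_lfunE addr_eq0. Qed.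

Lemma half2 x : 2^-1 *: (x + x) = x.
Proof.
by rewrite -{1 2}[x]scale1r -scalerDl scalerA mulVf ?scale1r ?pnatr_eq0.
Qed.
Lemma kpproj x : kproj x + pproj x = x.
Proof. by rewrite -scalerDr addrACA subrr addr0 half2. Qed.
Lemma kprojD x y : kproj (x + y) = kproj x + kproj y.
Proof. by rewrite /kproj thetaD addrACA scalerDr. Qed.
Lemma kprojZ a x : kproj (a *: x) = a *: kproj x.
Proof. by rewrite /kproj thetaZ -scalerDr !scalerA mulrC. Qed.
Lemma pprojD x y : pproj (x + y) = pproj x + pproj y.
Proof. by rewrite /pproj thetaD opprD addrACA scalerDr. Qed.
Lemma pprojZ a x : pproj (a *: x) = a *: pproj x.
Proof. by rewrite /pproj thetaZ -scalerBr !scalerA mulrC. Qed.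
Lemma theta_kproj x : theta (kproj x) = kproj x.
Proof. by rewrite thetaZ thetaD thetaK addrC. Qed.
Lemma theta_pproj x : theta (pproj x) = - pproj x.
Proof. by rewrite thetaZ thetaD thetaN thetaK -scalerN opprB addrC. Qed.
Lemma kproj_id x : theta x = x -> kproj x = x.
Proof. by move=> e; rewrite /kproj e half2. Qed.
Lemma kproj_0 x : theta x = - x -> kproj x = 0.
Proof. by move=> e; rewrite /kproj e subrr scaler0. Qed.
Lemma pproj_id x : theta x = - x -> pproj x = x.
Proof. by move=> e; rewrite /pproj e opprK half2. Qed.
Lemma pproj_0 x : theta x = x -> pproj x = 0.
Proof. by move=> e; rewrite /pproj e subrr scaler0. Qed.

End CartanDecomposition.

(* The complexified Lie algebra of the Cartan motion group: the vector space  *)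
(* g with a new bracket. *)
Section Motion.
Variables (F : numFieldType) (g : symLieType F).

Definition motion : Type := g.
HB.instance Definition _ := GRing.Lmodule.on motion.

Definition motion_lie (x y : motion) : motion :=
  lie (kproj x) (pproj y) + lie (pproj x) (kproj y) + lie (kproj x) (kproj y).

Let thkk (x y : g) : theta (lie (kproj x) (kproj y)) = lie (kproj x) (kproj y).
Proof. by rewrite theta_lie !theta_kproj. Qed.
Let thkp (x y : g) : theta (lie (kproj x) (pproj y)) = - lie (kproj x) (pproj y).
Proof. by rewrite theta_lie theta_kproj theta_pproj lieNr. Qed.
Let thpk (x y : g) : theta (lie (pproj x) (kproj y)) = - lie (pproj x) (kproj y).
Proof. by rewrite theta_lie theta_kproj theta_pproj lieNl. Qed.

Lemma kproj_motion_lie (x y : g) :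
  kproj (motion_lie x y) = lie (kproj x) (kproj y).
Proof.
rewrite /motion_lie !kprojD (kproj_id (thkk _ _)) (kproj_0 (thkp _ _)).
by rewrite (kproj_0 (thpk _ _)) !add0r.
Qed.
Lemma pproj_motion_lie (x y : g) :
  pproj (motion_lie x y) = lie (kproj x) (pproj y) + lie (pproj x) (kproj y).
Proof.
rewrite /motion_lie !pprojD (pproj_0 (thkk _ _)) (pproj_id (thkp _ _)).
by rewrite (pproj_id (thpk _ _)) addr0.
Qed.

Fact motion_linearl y a u v :
  motion_lie (a *: u + v) y = a *: motion_lie u y + motion_lie v y.
Proof.
rewrite /motion_lie kprojD pprojD kprojZ pprojZ !lie_linearl !scalerDr.
by rewrite [LHS](AC (2*2*2) ((1*3*5)*(2*4*6)))%AC.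
Qed.
Fact motion_linearr x a u v :
  motion_lie x (a *: u + v) = a *: motion_lie x u + motion_lie x v.
Proof.
rewrite /motion_lie kprojD pprojD kprojZ pprojZ !lie_linearr !scalerDr.
by rewrite [LHS](AC (2*2*2) ((1*3*5)*(2*4*6)))%AC.
Qed.
Fact motion_liexx x : motion_lie x x = 0.
Proof. by rewrite /motion_lie liexx addr0 [X in _ + X]lieC subrr. Qed.
Fact motion_jacobi (x y t : motion) : motion_lie x (motion_lie y t)
  + motion_lie y (motion_lie t x) + motion_lie t (motion_lie x y) = 0.
Proof.
have e (a b c : g) : motion_lie a (motion_lie b c) =
    lie (kproj a) (lie (kproj b) (pproj c))
    + lie (kproj a) (lie (pproj b) (kproj c))
    + lie (pproj a) (lie (kproj b) (kproj c))
    + lie (kproj a) (lie (kproj b) (kproj c)).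
  by rewrite {1}/motion_lie kproj_motion_lie pproj_motion_lie lieDr.
rewrite !e; have J := @lie_jacobi F g.
set X := kproj x; set X' := pproj x; set Y := kproj y; set Y' := pproj y.
set Z := kproj t; set Z' := pproj t.
have P (a1 a2 a3 a4 b1 b2 b3 b4 c1 c2 c3 c4 : g) :
    a1 + b2 + c3 = 0 -> a2 + b3 + c1 = 0 -> a3 + b1 + c2 = 0 ->
    a4 + b4 + c4 = 0 ->
  (a1 + a2 + a3 + a4) + (b1 + b2 + b3 + b4) + (c1 + c2 + c3 + c4) = 0.
  move=> h1 h2 h3 h4.
  rewrite [LHS](AC (4*4*4) ((4*8*12)*((1*6*11)*((2*7*9)*(3*5*10)))))%AC.
  by rewrite /= h4 h1 h2 h3 !addr0.
by apply: P; apply: J.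
Qed.
HB.instance Definition _ := isLie.Build F motion motion_linearl motion_linearr
  motion_liexx motion_jacobi.

End Motion.

(* The constant family F[z] (x) g, as a Lie algebra over F[z]. *)
Section ConstantFamily.
Variables (F : fieldType) (g : lieAlgType F).

Definition polyx : Type := tens {poly F} g.
HB.instance Definition _ := GRing.Zmodule.on polyx.

Definition pxpure (f : {poly F}) (x : g) : polyx := tpure f x.

Lemma pxpureDl f f' x : pxpure (f + f') x = pxpure f x + pxpure f' x.
Proof. exact: tpureDl. Qed.
Lemma pxpureDr f x x' : pxpure f (x + x') = pxpure f x + pxpure f x'.
Proof. exact: tpureDr. Qed.
Lemma pxpure0 f : pxpure f 0 = 0.
Proof. by apply: (addrI (pxpure f 0)); rewrite -pxpureDr !addr0. Qed.
Lemma pxpureZ c f x : pxpure (c *: f) x = pxpure f (c *: x).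
Proof. by rewrite /pxpure tpureZl tpureZr. Qed.
Lemma px_ind (P : polyx -> Prop) :
  P 0 -> (forall s t, P s -> P t -> P (s + t)) -> (forall f x, P (pxpure f x)) ->
  forall t, P t.
Proof. exact: tens_ind. Qed.

Section PxLift.
Variables (V : zmodType) (f : {poly F} -> g -> V).
Hypothesis fDl : forall m m' n, f (m + m') n = f m n + f m' n.
Hypothesis fDr : forall m n n', f m (n + n') = f m n + f m n'.
Hypothesis fZ : forall r m n, f (r *: m) n = f m (r *: n).
Lemma pxlift_pure m n : tlift f (pxpure m n) = f m n.
Proof. exact: tlift_pure. Qed.
Lemma pxliftD (s t : polyx) : tlift f (s + t) = tlift f s + tlift f t.
Proof. exact: tliftD. Qed.
Lemma pxlift0 : tlift f (0 : polyx) = 0.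
Proof. by apply: (addrI (tlift f (0 : polyx))); rewrite -pxliftD !addr0. Qed.
End PxLift.

Definition px_scale (f : {poly F}) (t : polyx) : polyx :=
  tlift (fun h x => pxpure (f * h) x) t.

Let scD1 f (m m' : {poly F}) n :
  pxpure (f * (m + m')) n = pxpure (f * m) n + pxpure (f * m') n.
Proof. by rewrite mulrDr pxpureDl. Qed.
Let scD2 f (m : {poly F}) (n n' : g) :
  pxpure (f * m) (n + n') = pxpure (f * m) n + pxpure (f * m) n'.
Proof. exact: pxpureDr. Qed.
Let scZ f c (m : {poly F}) n : pxpure (f * (c *: m)) n = pxpure (f * m) (c *: n).
Proof. by rewrite -scalerAr pxpureZ. Qed.

Lemma px_scale_pure f h x : px_scale f (pxpure h x) = pxpure (f * h) x.
Proof. exact: (pxlift_pure (scD1 f) (scD2 f) (scZ f)). Qed.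
Fact px_scaleDr : right_distributive px_scale +%R.
Proof. move=> f; exact: (pxliftD (scD1 f) (scD2 f) (scZ f)). Qed.
Let px_scale0 f : px_scale f 0 = 0.
Proof. exact: (pxlift0 (scD1 f) (scD2 f) (scZ f)). Qed.
Fact px_scaleA a b t : px_scale a (px_scale b t) = px_scale (a * b) t.
Proof.
elim/px_ind: t => [|s t IHs IHt|h x]; first by rewrite !px_scale0.
  by rewrite !px_scaleDr IHs IHt.
by rewrite !px_scale_pure mulrA.
Qed.
Fact px_scale1 : left_id 1 px_scale.
Proof.
elim/px_ind => [|s t IHs IHt|h x]; first by rewrite px_scale0.
  by rewrite px_scaleDr IHs IHt.
by rewrite px_scale_pure mul1r.
Qed.
Fact px_scaleDl t : {morph px_scale^~ t : a b / a + b}.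
Proof.
move=> a b; elim/px_ind: t => [|s t IHs IHt|h x].
- by rewrite !px_scale0 addr0.
- by rewrite !px_scaleDr IHs IHt addrACA.
- by rewrite !px_scale_pure mulrDl pxpureDl.
Qed.
HB.instance Definition _ := GRing.Zmodule_isLmodule.Build {poly F} polyx
  px_scaleA px_scale1 px_scaleDr px_scaleDl.

Lemma pxpure_scale f h x : f *: pxpure h x = pxpure (f * h) x.
Proof. exact: px_scale_pure. Qed.

(* The F[z]-bilinear extension of an F-bilinear map b on g. *)
Section Extend.
Variables (V : lmodType {poly F}) (b : g -> g -> V).
Definition px_ext (s t : polyx) : V :=
  tlift (fun f x => tlift (fun h y => (f * h) *: b x y) t) s.

Hypothesis bl : forall y a u v, b (a *: u + v) y = a%:P *: b u y + b v y.
Hypothesis br : forall x a u v, b x (a *: u + v) = a%:P *: b x u + b x v.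

Let bDl y u v : b (u + v) y = b u y + b v y.
Proof. by have := bl y 1 u v; rewrite !scale1r. Qed.
Let bDr x u v : b x (u + v) = b x u + b x v.
Proof. by have := br x 1 u v; rewrite !scale1r. Qed.
Let b0l y : b 0 y = 0.
Proof. by apply: (addrI (b 0 y)); rewrite -bDl !addr0. Qed.
Let b0r x : b x 0 = 0.
Proof. by apply: (addrI (b x 0)); rewrite -bDr !addr0. Qed.
Let bZl a x y : b (a *: x) y = a%:P *: b x y.
Proof. by have := bl y a x 0; rewrite b0l !addr0. Qed.
Let bZr a x y : b x (a *: y) = a%:P *: b x y.
Proof. by have := br x a y 0; rewrite b0r !addr0. Qed.

Let iD1 (f : {poly F}) x (h h' : {poly F}) y :
  (f * (h + h')) *: b x y = (f * h) *: b x y + (f * h') *: b x y.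
Proof. by rewrite mulrDr scalerDl. Qed.
Let iD2 (f : {poly F}) x (h : {poly F}) y y' :
  (f * h) *: b x (y + y') = (f * h) *: b x y + (f * h) *: b x y'.
Proof. by rewrite bDr scalerDr. Qed.
Let iZ (f : {poly F}) x c (h : {poly F}) y :
  (f * (c *: h)) *: b x y = (f * h) *: b x (c *: y).
Proof.
by rewrite bZr scalerA; congr (_ *: _); rewrite -mul_polyC mulrCA mulrC.
Qed.
Let inner f x t := tlift (fun h y => (f * h) *: b x y) t.
Let inner_pure f x h y : inner f x (pxpure h y) = (f * h) *: b x y.
Proof. exact: (pxlift_pure (iD1 f x) (iD2 f x) (iZ f x)). Qed.
Let innerD f x s t : inner f x (s + t) = inner f x s + inner f x t.
Proof. exact: (pxliftD (iD1 f x) (iD2 f x) (iZ f x)). Qed.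
Let inner0 f x : inner f x (0 : polyx) = 0.
Proof. exact: (pxlift0 (iD1 f x) (iD2 f x) (iZ f x)). Qed.
Let oD1 t f f' x : inner (f + f') x t = inner f x t + inner f' x t.
Proof.
elim/px_ind: t => [|s t IHs IHt|h y]; first by rewrite !inner0 addr0.
  by rewrite !innerD IHs IHt addrACA.
by rewrite !inner_pure mulrDl scalerDl.
Qed.
Let oD2 t f x x' : inner f (x + x') t = inner f x t + inner f x' t.
Proof.
elim/px_ind: t => [|s t IHs IHt|h y]; first by rewrite !inner0 addr0.
  by rewrite !innerD IHs IHt addrACA.
by rewrite !inner_pure bDl scalerDr.
Qed.
Let oZ t c f x : inner (c *: f) x t = inner f (c *: x) t.
Proof.
elim/px_ind: t => [|s t IHs IHt|h y]; first by rewrite !inner0.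
  by rewrite !innerD IHs IHt.
rewrite !inner_pure bZl scalerA; congr (_ *: _).
by rewrite -mul_polyC [RHS]mulrC mulrA.
Qed.

Let ext_l f x t : px_ext (pxpure f x) t = inner f x t.
Proof. exact: (pxlift_pure (oD1 t) (oD2 t) (oZ t)). Qed.
Lemma px_ext_pure f x h y :
  px_ext (pxpure f x) (pxpure h y) = (f * h) *: b x y.
Proof. by rewrite ext_l inner_pure. Qed.
Lemma px_extDl s s' t : px_ext (s + s') t = px_ext s t + px_ext s' t.
Proof. exact: (pxliftD (oD1 t) (oD2 t) (oZ t)). Qed.
Lemma px_ext0l t : px_ext 0 t = 0.
Proof. exact: (pxlift0 (oD1 t) (oD2 t) (oZ t)). Qed.
Lemma px_extDr s t t' : px_ext s (t + t') = px_ext s t + px_ext s t'.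
Proof.
elim/px_ind: s => [|s s' IHs IHt|h y]; first by rewrite !px_ext0l addr0.
  by rewrite !px_extDl IHs IHt addrACA.
by rewrite !ext_l innerD.
Qed.
Lemma px_ext0r s : px_ext s 0 = 0.
Proof. by apply: (addrI (px_ext s 0)); rewrite -px_extDr !addr0. Qed.
Lemma px_extZl f s t : px_ext (f *: s) t = f *: px_ext s t.
Proof.
elim/px_ind: s => [|s s' IH IH'|h x]; first by rewrite scaler0 px_ext0l scaler0.
  by rewrite scalerDr !px_extDl IH IH' scalerDr.
elim/px_ind: t => [|s s' IH IH'|k y]; first by rewrite !px_ext0r scaler0.
  by rewrite !px_extDr IH IH' scalerDr.
by rewrite pxpure_scale !px_ext_pure scalerA mulrA.
Qed.
Lemma px_extZr f s t : px_ext s (f *: t) = f *: px_ext s t.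
Proof.
elim/px_ind: s => [|s s' IH IH'|h x]; first by rewrite !px_ext0l scaler0.
  by rewrite !px_extDl IH IH' scalerDr.
elim/px_ind: t => [|s s' IH IH'|k y].
- by rewrite scaler0 !px_ext0r scaler0.
- by rewrite scalerDr !px_extDr IH IH' scalerDr.
- by rewrite pxpure_scale !px_ext_pure scalerA mulrCA.
Qed.
End Extend.

Definition px_lie : polyx -> polyx -> polyx :=
  px_ext (fun x y => pxpure 1 (lie x y)).

Let lie_l y a u v :
  pxpure 1 (lie (a *: u + v) y) = a%:P *: pxpure 1 (lie u y) + pxpure 1 (lie v y).
Proof. by rewrite lie_linearl pxpureDr -pxpureZ pxpure_scale mul_polyC. Qed.
Let lie_r x a u v :
  pxpure 1 (lie x (a *: u + v)) = a%:P *: pxpure 1 (lie x u) + pxpure 1 (lie x v).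
Proof. by rewrite lie_linearr pxpureDr -pxpureZ pxpure_scale mul_polyC. Qed.

Lemma px_lie_pure f x h y :
  px_lie (pxpure f x) (pxpure h y) = pxpure (f * h) (lie x y).
Proof. by rewrite /px_lie (px_ext_pure lie_l lie_r) pxpure_scale mulr1. Qed.
Let lieD1 s s' t : px_lie (s + s') t = px_lie s t + px_lie s' t.
Proof. exact: (px_extDl lie_l lie_r). Qed.
Let lieD2 s t t' : px_lie s (t + t') = px_lie s t + px_lie s t'.
Proof. exact: (px_extDr lie_l lie_r). Qed.
Let lie01 t : px_lie 0 t = 0.
Proof. exact: (px_ext0l lie_l lie_r). Qed.
Let lie02 t : px_lie t 0 = 0.
Proof. exact: (px_ext0r lie_l lie_r). Qed.
Fact px_lie_linearl t a u v : px_lie (a *: u + v) t = a *: px_lie u t + px_lie v t.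
Proof. by rewrite lieD1; congr (_ + _); exact: (px_extZl lie_l lie_r). Qed.
Fact px_lie_linearr t a u v : px_lie t (a *: u + v) = a *: px_lie t u + px_lie t v.
Proof. by rewrite lieD2; congr (_ + _); exact: (px_extZr lie_l lie_r). Qed.
Let px_lieC s t : px_lie s t + px_lie t s = 0.
Proof.
elim/px_ind: s => [|s s' IH IH'|f x]; first by rewrite lie01 lie02 addr0.
  by rewrite lieD1 lieD2 addrACA IH IH' addr0.
elim/px_ind: t => [|s s' IH IH'|h y]; first by rewrite lie01 lie02 addr0.
  by rewrite lieD1 lieD2 addrACA IH IH' addr0.
by rewrite !px_lie_pure mulrC -pxpureDr [lie x y]lieC addNr pxpure0.
Qed.
Fact px_liexx t : px_lie t t = 0.
Proof.
elim/px_ind: t => [|s t IHs IHt|f x]; first by rewrite lie01.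
  by rewrite lieD1 !lieD2 IHs IHt add0r addr0 px_lieC.
by rewrite px_lie_pure liexx pxpure0.
Qed.
Fact px_jacobi s t u : px_lie s (px_lie t u) + px_lie t (px_lie u s)
  + px_lie u (px_lie s t) = 0.
Proof.
elim/px_ind: s => [|s s' IH IH'|f x].
- by rewrite !(lie01, lie02) !addr0.
- rewrite !(lieD1, lieD2).
  by rewrite [LHS](AC (2*2*2) ((1*3*5)*(2*4*6)))%AC /= IH IH' addr0.
elim/px_ind: t => [|s s' IH IH'|h y].
- by rewrite !(lie01, lie02) !addr0.
- rewrite !(lieD1, lieD2).
  by rewrite [LHS](AC (2*2*2) ((1*3*5)*(2*4*6)))%AC /= IH IH' addr0.
elim/px_ind: u => [|s s' IH IH'|k z].
- by rewrite !(lie01, lie02) !addr0.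
- rewrite !(lieD1, lieD2).
  by rewrite [LHS](AC (2*2*2) ((1*3*5)*(2*4*6)))%AC /= IH IH' addr0.
have -> : px_lie (pxpure h y) (px_lie (pxpure k z) (pxpure f x))
    = pxpure (f * (h * k)) (lie y (lie z x)).
  by rewrite !px_lie_pure mulrA mulrC.
have -> : px_lie (pxpure k z) (px_lie (pxpure f x) (pxpure h y))
    = pxpure (f * (h * k)) (lie z (lie x y)).
  by rewrite !px_lie_pure mulrCA [k * h]mulrC.
by rewrite !px_lie_pure -!pxpureDr lie_jacobi pxpure0.
Qed.
HB.instance Definition _ := isLie.Build {poly F} polyx px_lie_linearl
  px_lie_linearr px_liexx px_jacobi.

End ConstantFamily.

Section Deformation.
Variables (F : numFieldType) (g : symLieType F).

(* F[z] (x) k and z F[z] (x) p inside the constant family. *)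
Inductive kd_mem : polyx g -> Prop :=
| KD_pure f x : theta x = x -> kd_mem (pxpure f x)
| KD_0 : kd_mem 0
| KD_D u v : kd_mem u -> kd_mem v -> kd_mem (u + v).

Inductive pd_mem : polyx g -> Prop :=
| PD_pure f x : theta x = - x -> pd_mem (pxpure ('X * f) x)
| PD_0 : pd_mem 0
| PD_D u v : pd_mem u -> pd_mem v -> pd_mem (u + v).

Lemma kd_Z a u : kd_mem u -> kd_mem (a *: u).
Proof.
elim=> [f x hx||s t _ IHs _ IHt].
- by rewrite pxpure_scale; exact: KD_pure.
- by rewrite scaler0; exact: KD_0.
- by rewrite scalerDr; exact: KD_D.
Qed.
Lemma pd_Z a u : pd_mem u -> pd_mem (a *: u).
Proof.
elim=> [f x hx||s t _ IHs _ IHt].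
- by rewrite pxpure_scale mulrCA; exact: PD_pure.
- by rewrite scaler0; exact: PD_0.
- by rewrite scalerDr; exact: PD_D.
Qed.

Definition deform_pred : {pred polyx g} :=
  fun u => `[< exists v w, [/\ kd_mem v, pd_mem w & u = v + w] >].
Definition deform_p_pred : {pred polyx g} := fun u => `[< pd_mem u >].

Lemma kd_deform u : kd_mem u -> u \in deform_pred.
Proof.
by move=> hu; apply/asboolP; exists u, 0; split=> //; rewrite ?addr0 //;
  exact: PD_0.
Qed.
Lemma pd_deform u : pd_mem u -> u \in deform_pred.
Proof.
by move=> hu; apply/asboolP; exists 0, u; split=> //; rewrite ?add0r //;
  exact: KD_0.
Qed.

Fact deform_submod : submod_closed deform_pred.
Proof.
split=> [|a u v]; first exact/kd_deform/KD_0.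
move=> /asboolP[u1 [u2 [h1 h2 ->]]] /asboolP[v1 [v2 [k1 k2 ->]]].
apply/asboolP; exists (a *: u1 + v1), (a *: u2 + v2); split.
- by apply: KD_D k1; exact: kd_Z.
- by apply: PD_D k2; exact: pd_Z.
- by rewrite scalerDr addrACA.
Qed.
Fact deform_p_submod : submod_closed deform_p_pred.
Proof.
split=> [|a u v]; first exact/asboolP/PD_0.
by move=> /asboolP hu /asboolP hv; apply/asboolP/PD_D => //; exact: pd_Z.
Qed.
HB.instance Definition _ :=
  GRing.isSubmodClosed.Build {poly F} (polyx g) deform_pred deform_submod.
HB.instance Definition _ :=
  GRing.isSubmodClosed.Build {poly F} (polyx g) deform_p_pred deform_p_submod.

Record deform := Deform { deform_val : polyx g; _ : deform_val \in deform_pred }.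
HB.instance Definition _ := [isSub for deform_val].
HB.instance Definition _ := [Choice of deform by <:].
HB.instance Definition _ := [SubChoice_isSubLmodule of deform by <:].

Record deform_p :=
  DeformP { deform_p_val : polyx g; _ : deform_p_val \in deform_p_pred }.
HB.instance Definition _ := [isSub for deform_p_val].
HB.instance Definition _ := [Choice of deform_p by <:].
HB.instance Definition _ := [SubChoice_isSubLmodule of deform_p by <:].

Let lie_pxpure f h (x y : g) :
  lie (pxpure f x) (pxpure h y) = pxpure (f * h) (lie x y).
Proof. exact: px_lie_pure. Qed.

Lemma lie_deform u v :
  u \in deform_pred -> v \in deform_pred -> lie u v \in deform_pred.
Proof.
have KK a b : kd_mem a -> kd_mem b -> kd_mem (lie a b).
  elim=> [f x hx||s t _ IHs _ IHt] hb.
  - elim: hb => [h y hy||s t _ IHs _ IHt].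
    + rewrite lie_pxpure; apply: KD_pure; by rewrite theta_lie hx hy.
    + by rewrite liex0; exact: KD_0.
    + by rewrite lieDr; exact: KD_D.
  - by rewrite lie0x; exact: KD_0.
  - by rewrite lieDl; apply: KD_D; [exact: IHs | exact: IHt].
have KP a b : kd_mem a -> pd_mem b -> pd_mem (lie a b).
  elim=> [f x hx||s t _ IHs _ IHt] hb.
  - elim: hb => [h y hy||s t _ IHs _ IHt].
    + rewrite lie_pxpure mulrCA; apply: PD_pure.
      by rewrite theta_lie hx hy lieNr.
    + by rewrite liex0; exact: PD_0.
    + by rewrite lieDr; exact: PD_D.
  - by rewrite lie0x; exact: PD_0.
  - by rewrite lieDl; apply: PD_D; [exact: IHs | exact: IHt].
have PP a b : pd_mem a -> pd_mem b -> kd_mem (lie a b).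
  elim=> [f x hx||s t _ IHs _ IHt] hb.
  - elim: hb => [h y hy||s t _ IHs _ IHt].
    + rewrite lie_pxpure; apply: KD_pure.
      by rewrite theta_lie hx hy lieNr lieNl opprK.
    + by rewrite liex0; exact: KD_0.
    + by rewrite lieDr; exact: KD_D.
  - by rewrite lie0x; exact: KD_0.
  - by rewrite lieDl; apply: KD_D; [exact: IHs | exact: IHt].
move=> /asboolP[u1 [u2 [h1 h2 ->]]] /asboolP[v1 [v2 [k1 k2 ->]]].
rewrite lieDl !lieDr; apply: rpredD; apply: rpredD.
- exact/kd_deform/KK.
- exact/pd_deform/KP.
- by rewrite lieC rpredN; exact/pd_deform/KP.
- exact/kd_deform/PP.
Qed.

Definition deform_lie (u v : deform) : deform :=
  Deform (lie_deform (valP u) (valP v)).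
Fact deform_lie_linearl t a u v :
  deform_lie (a *: u + v) t = a *: deform_lie u t + deform_lie v t.
Proof. by apply: val_inj; exact: lie_linearl. Qed.
Fact deform_lie_linearr t a u v :
  deform_lie t (a *: u + v) = a *: deform_lie t u + deform_lie t v.
Proof. by apply: val_inj; exact: lie_linearr. Qed.
Fact deform_liexx t : deform_lie t t = 0.
Proof. by apply: val_inj; exact: liexx. Qed.
Fact deform_jacobi s t u : deform_lie s (deform_lie t u)
  + deform_lie t (deform_lie u s) + deform_lie u (deform_lie s t) = 0.
Proof. by apply: val_inj; exact: lie_jacobi. Qed.
HB.instance Definition _ := isLie.Build {poly F} deform deform_lie_linearl
  deform_lie_linearr deform_liexx deform_jacobi.

Fact deform_p_sub (u : deform_p) : val u \in deform_pred.
Proof. by have /asboolP := valP u; exact: pd_deform. Qed.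
Definition deform_incl (u : deform_p) : deform := Deform (deform_p_sub u).

Definition motion_incl (x : subvs_of (pspace g)) : motion g := vsval x.

Section Forms.
Variable beta : g -> g -> F.

Definition beta0 (x y : subvs_of (pspace g)) : F := beta (vsval x) (vsval y).

(* z^2 beta_d = 1 (x) beta; the division is exact on p_d. *)
Definition beta_d (u v : deform_p) : {poly F} :=
  px_ext (fun x y => (beta x y)%:P : {poly F}^o) (val u) (val v) %/ 'X^2.

End Forms.

(* f (x) x |-> f(0) x for x in k, f'(0) x for x in p; the decomposition       *)
(* x = kproj x + pproj x handles both cases at once.                          *)
Definition eta (u : zfib deform) : motion g :=
  tlift (fun (f : {poly F}) (x : g) => f.[0] *: kproj x + f^`().[0] *: pproj x)
    (val (repr u)).

(* z h (x) x |-> h(0) x; for f = z h, the coefficient f`_1 is h(0). *)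
Definition isom_p (u : zfib deform_p) : subvs_of (pspace g) :=
  vsproj (pspace g) (tlift (fun (f : {poly F}) (x : g) => f`_1 *: x) (val (repr u))).

End Deformation.

Section Dirac.
Variables (R : comNzRingType) (P : lmodType R) (b : P -> P -> R).

(* P (x) P -> End(P) along P -> P^*, X |-> b(X, -). *)
Definition contract (w : tens P P) (x : P) : P :=
  tlift (fun u v => b u x *: v) w.

(* The element of P (x) P corresponding to Id_P. *)
Definition id_tensor : tens P P :=
  xget 0 [set w | forall x, contract w x = x].

Variables (L : lieAlgType R) (incl : P -> L).

Definition dirac : tens (uenv L) (cliff b) :=
  tlift (fun u v => tpure (uenv_gen (incl u)) (cliff_gen b v)) id_tensor.

Definition dirac_basis (n : nat) (e e' : n.-tuple P) : tens (uenv L) (cliff b) :=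
  \sum_(i < n) tpure (uenv_gen (incl (tnth e i))) (cliff_gen b (tnth e' i)).

End Dirac.

Section PhiA.
Variables (F : numFieldType) (g : symLieType F) (beta : g -> g -> F).

Definition alg_d : assocAlgType {poly F} :=
  tens (uenv (deform g)) (cliff (beta_d beta)).
Definition alg_0 : assocAlgType F :=
  tens (uenv (motion g)) (cliff (beta0 beta)).

Definition dirac_d : alg_d := dirac (beta_d beta) (@deform_incl F g).

Definition dirac_0 (n : nat) (e e' : n.-tuple (subvs_of (pspace g))) : alg_0 :=
  dirac_basis (beta0 beta) (@motion_incl F g) e e'.

Definition Phi_U (u : zfib (uenv (deform g))) : uenv (motion g) :=
  uenv_map (@eta F g) (inverse_map (@uenv_base_change F (deform g)) u).

Definition Phi_Cl (c : zfib (cliff (beta_d beta))) : cliff (beta0 beta) :=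
  cliff_map (beta0 beta) (@isom_p F g)
    (inverse_map (@cliff_base_change F (deform_p g) (beta_d beta)) c).

Definition Phi_A (a : zfib alg_d) : alg_0 := tens_map Phi_U Phi_Cl (zfib_tens a).

End PhiA.

Import numFieldNormedType.Exports.
Local Open Scope classical_set_scope.

Definition Cx (R : realType) : numClosedFieldType := R[i]%C.

(* Complex linear algebraic groups, as Zariski closed subgroups of GL_n. *)
Section LinearGroups.
Variables (R : realType) (n : nat).
Local Notation C := (Cx R).
Local Notation M := 'M[C]_n.
Implicit Types (G H : set M) (s : M -> M).

Inductive polyfun : (M -> C) -> Prop :=
| PF_cst c : polyfun (fun _ => c)
| PF_coord i j : polyfun (fun A => A i j)
| PF_add p q : polyfun p -> polyfun q -> polyfun (fun A => p A + q A)
| PF_mul p q : polyfun p -> polyfun q -> polyfun (fun A => p A * q A).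

Definition zariski_closed G :=
  exists S : set (M -> C), (forall p, S p -> polyfun p) /\
    G = [set A | A \in unitmx /\ forall p, S p -> p A = 0].

Definition is_subgroup G := [/\ G 1%:M,
  (forall A B, G A -> G B -> G (A *m B)) & (forall A, G A -> G (invmx A))].

Definition algebraic_group G :=
  zariski_closed G /\ is_subgroup G.

Definition zariski_connected G := forall X Y,
  zariski_closed X -> zariski_closed Y -> G = X `|` Y -> X `&` Y = set0 ->
  X = set0 \/ Y = set0.

Definition unipotent (A : M) := exists k : nat, (A - 1%:M) ^+ k = 0.

(* Trivial unipotent radical. *)
Definition reductive G := forall U, algebraic_group U -> zariski_connected U ->
  U `<=` G -> (forall A B, G A -> U B -> U (A *m B *m invmx A)) ->
  (forall A, U A -> unipotent A) -> U = [set 1%:M].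

Definition connected_reductive_group G :=
  [/\ algebraic_group G, zariski_connected G & reductive G].

Definition involution_on G s := [/\ (forall A, G A -> G (s A)),
  (forall A B, G A -> G B -> s (A *m B) = s A *m s B) &
  (forall A, G A -> s (s A) = A)].

(* Holomorphic at A as a function on the complex submanifold G: near A it is  *)
(* the restriction of a holomorphic function on an open set of matrices.      *)
Definition holomorphic_on G (f : M -> C) := forall A, G A ->
  exists h : M -> C, \forall B \near A,
    differentiable h B /\ (G B -> f B = h B).

Definition antiholomorphic_involution G s :=
  involution_on G s /\ forall i j, holomorphic_on G (fun A => (s A i j)^*).

Definition algebraic_involution G s :=
  involution_on G s /\ forall i j, exists (p : M -> C) (k : nat),
    polyfun p /\ forall A, G A -> s A i j = p A / (\det A) ^+ k.

Definition fixed_points G s : set M := [set A | G A /\ s A = A].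

Definition maximal_compact H G := [/\ is_subgroup H, H `<=` G, compact H &
  forall H', is_subgroup H' -> compact H' -> H `<=` H' -> H' `<=` G -> H' = H].

(* th is an algebraic involution commuting with s, for which the real form of *)
(* G defined by th s is compact.                                              *)
Definition cartan_involution G s th := [/\ algebraic_involution G th,
  (forall A, G A -> th (s A) = s (th A)),
  compact (fixed_points G (th \o s)) &
  maximal_compact (fixed_points (fixed_points G th) s) (fixed_points G s)].

Definition expmx (A : M) : M :=
  limn (series (fun k : nat => (k`!%:R : C)^-1 *: A ^+ k)).

Section LieOfGroup.
Variables (g : lieAlgType C) (iota : {linear g -> M}).

(* iota identifies g with Lie(G) inside the matrix algebra. *)
Definition is_lie_algebra_of G := [/\ injective iota,
  (forall A : M, (exists x, iota x = A) <->
     forall t : C, t \is Num.real -> G (expmx (t *: A))) &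
  (forall x y, iota (lie x y) = iota x *m iota y - iota y *m iota x)].

Definition is_differential s (ds : g -> g) := forall x (t : C),
  t \is Num.real -> s (expmx (t *: iota x)) = expmx (t *: iota (ds x)).

End LieOfGroup.

End LinearGroups.

Section InvariantForm.
Variables (R : realType) (n : nat).
Local Notation C := (Cx R).
Variables (G : set 'M[C]_n) (Theta : 'M[C]_n -> 'M[C]_n).
Variables (g : symLieType C) (iota : {linear g -> 'M[C]_n}).
Variables (dsigma : g -> g) (beta : g -> g -> C).

Definition trace (f : g -> g) : C :=
  \sum_(i < \dim {:g}) coord (vbasis {:g}) i (f (vbasis {:g})`_i).

Definition killing (x y : g) : C := trace (fun u => lie x (lie y u)).

Definition derived (x : g) :=
  exists s : seq (g * g), x = \sum_(p <- s) lie p.1 p.2.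

Definition symmetric_bilinear := (forall x y, beta x y = beta y x) /\
  (forall y a u v, beta (a *: u + v) y = a * beta u y + beta v y).

Definition cartan_form := [/\ symmetric_bilinear,
  (forall x y, derived x -> derived y -> beta x y = killing x y),
  (forall x, theta x = - x -> dsigma x = x -> x != 0 -> 0 < beta x x) /\
  (forall x, theta x = x -> dsigma x = x -> x != 0 -> beta x x < 0),
  (forall x y, beta (theta x) (theta y) = beta x y) &
  (forall A x y x' y', fixed_points G Theta A ->
     iota x' = A *m iota x *m invmx A -> iota y' = A *m iota y *m invmx A ->
     beta x' y' = beta x y) /\
  (forall x y t, beta (lie t x) y + beta x (lie t y) = 0)].

End InvariantForm.

(* Main.v *)
(* The tensor representing Id is unique: expanding left factors in a basis    *)
(* recovers it from the endomorphism. Hence, if e is a basis of p_0 with dual *)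
(* basis e', the families z (x) e_i and z (x) e'_i are dual bases of p_d for  *)
(* beta_d, and D(g_d, beta_d) is the sum of the (z (x) e_i) (x) gamma_d(z (x) *)
(* e'_i). It remains to follow these generators through Phi_A, which inverts  *)
(* the base-change maps: their inverses are induced by evaluating scalars at  *)
(* z = 0 and sending a generator x to the generator given by the class of x.  *)
(* Finally eta and the isometry p_d|_0 -> p send the class of z (x) e_i to    *)
(* e_i.                                                                       *)

From HB Require Import structures.
Require Import Defs.
From mathcomp Require Import all_boot all_order all_algebra complex.
From mathcomp Require Import all_classical all_reals all_analysis.
Import Order.TTheory GRing.Theory Num.Theory.
Import numFieldNormedType.Exports.
Local Open Scope ring_scope.

Set Implicit Arguments.
Unset Strict Implicit.
Unset Printing Implicit Defensive.

(** Write [zp x] for z (x) x. The rescaling of the form by z^-2 cancels the factor z in p_d: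
    [beta_d] of [zp x] and [zp y] is the constant beta0(x, y) ([beta_d_zp]). So dual bases of p_0
    give dual bases of p_d over F[z], and the Dirac operator of the family is a sum of pure tensors
    of generators ([id_tensor_dual_basis], [dirac_dE]). Each factor of [Phi_A] sends the class of
    the generator at [zp x] to the generator at x, and the equality holds term by term
    ([Phi_A_dirac]).

    The work lies in showing that these factors behave as intended, since maps out of quotients are
    defined on chosen representatives and inverses by choice. Enveloping and Clifford algebras are
    treated together as quotients of a tensor algebra. [pres_lift] is their universal property along
    a change of scalars, and [inverse_base_change] identifies the chosen inverse of base change with
    the map induced by evaluation at z = 0. The maps on generators extend to the algebras because
    [eta] respects brackets ([eta_lie]; the bracket of two elements of p_d carries a factor z^2 and
    dies in the zero fiber) and [isom_p] is an isometry ([isom_p_isometry]). *)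

Lemma morphD_0 (U V : zmodType) (f : U -> V) : {morph f : x y / x + y} -> f 0 = 0.
Proof. by move=> fD; apply: (addrI (f 0)); rewrite -fD !addr0. Qed.

Lemma morphD_N (U V : zmodType) (f : U -> V) : {morph f : x y / x + y} ->
  {morph f : x / - x}.
Proof.
by move=> fD x; apply: (addrI (f x)); rewrite -fD !subrr (morphD_0 fD).
Qed.

Lemma morphD_B (U V : zmodType) (f : U -> V) : {morph f : x y / x + y} ->
  {morph f : x y / x - y}.
Proof. by move=> fD x y; rewrite fD (morphD_N fD). Qed.

(** Existence of a preimage rules out the default value 0 of [xget], and injectivity forces the
    chosen preimage to be [h y]. *)
Lemma inverse_map_cancel (X Y : zmodType) (f : X -> Y) (h : Y -> X) :
  cancel f h -> cancel h f -> inverse_map f =1 h.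
Proof.
move=> fK hK y; rewrite /inverse_map; case: xgetP => [x _ /= <-|/(_ (h y))].
  by rewrite fK.
by rewrite /= hK.
Qed.

(** * Balanced maps on sums of pure tensors *)

Section BalancedLift.
Variables (R : comNzRingType) (M N : lmodType R).

(** [tlift] sums over a chosen representative; for a balanced map the value does not depend on that
    choice, so the given sum of pure tensors may serve instead. *)
Lemma tlift_sum (V : zmodType) (f : M -> N -> V) (I : Type) (r : seq I)
    (u : I -> M) (v : I -> N) :
  (forall m m' n, f (m + m') n = f m n + f m' n) ->
  (forall m n n', f m (n + n') = f m n + f m n') ->
  (forall c m n, f (c *: m) n = f m (c *: n)) ->
  tlift f (\sum_(i <- r) tpure (u i) (v i)) = \sum_(i <- r) f (u i) (v i).
Proof.
move=> fDl fDr fZ.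
have -> : \sum_(i <- r) tpure (u i) (v i) = tcls [seq (u i, v i) | i <- r].
  by rewrite tens_piE big_map.
by rewrite (tlift_pi fDl fDr fZ) big_map.
Qed.

Lemma tens_map_sum (M' N' : lmodType R) (f : M -> M') (h : N -> N') (I : Type)
    (r : seq I) (u : I -> M) (v : I -> N) :
  {morph f : x y / x + y} -> scalable f ->
  {morph h : x y / x + y} -> scalable h ->
  tens_map f h (\sum_(i <- r) tpure (u i) (v i))
  = \sum_(i <- r) tpure (f (u i)) (h (v i)).
Proof.
move=> fD fZ hD hZ; apply: tlift_sum.
- by move=> m m' n; rewrite fD tpureDl.
- by move=> m n n'; rewrite hD tpureDr.
- by move=> c m n; rewrite fZ hZ tpureZl tpureZr.
Qed.

End BalancedLift.

(** * Zero fibers *)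

Section ZeroFiberTheory.
Variables (F : comNzRingType) (M : lmodType {poly F}).

Lemma zclsB (x y : M) : zcls (x - y) = zcls x - zcls y.
Proof. exact: (qclsB (zmul_sub M)). Qed.

(** f - f(0) is divisible by z, so polynomials act on the zero fiber through their value at 0. *)
Lemma zclsZ_horner (f : {poly F}) (m : M) : zcls (f *: m) = f.[0] *: zcls m.
Proof.
elim/poly_ind: f => [|q c _].
  by rewrite scale0r horner0 scale0r; exact: (qcls0 (zmul_sub M)).
rewrite hornerMXaddC mulr0 add0r -zclsZ; apply/zclsP; exists (q *: m).
by rewrite scalerDl addrK scalerA mulrC.
Qed.

(** Maps out of a zero fiber are coded by applying a map to a representative; this is the criterion
    for the choice to be immaterial. *)
Lemma zfib_descend (V : zmodType) (phi : M -> V) :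
  {morph phi : x y / x + y} -> (forall x, phi ('X *: x) = 0) ->
  forall x, phi (repr (zcls x)) = phi x.
Proof.
move=> phiD phiX x; have [y hy] := zreprP x.
by apply/eqP; rewrite -subr_eq0 -(morphD_B phiD) hy phiX.
Qed.

End ZeroFiberTheory.

(** A polynomial crosses the tensor sign as its value at 0, so the map is balanced over F[z]
    although its target is a tensor product over F. *)
Lemma zfib_tens_sum (F : comNzRingType) (M N : lmodType {poly F}) (I : Type)
    (r : seq I) (u : I -> M) (v : I -> N) :
  zfib_tens (zcls (\sum_(i <- r) tpure (u i) (v i)))
  = \sum_(i <- r) tpure (zcls (u i)) (zcls (v i)).
Proof.
pose f (x : M) (y : N) := tpure (zcls x) (zcls y).
have fDl m m' n : f (m + m') n = f m n + f m' n.
  by rewrite /f zclsD tpureDl.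
have fDr m n n' : f m (n + n') = f m n + f m n'.
  by rewrite /f zclsD tpureDr.
have fZ c m n : f (c *: m) n = f m (c *: n).
  by rewrite /f !zclsZ_horner tpureZl tpureZr.
rewrite -(tlift_sum r u v fDl fDr fZ).
apply: (@zfib_descend _ _ _ (tlift f)) => [s t|t]; first exact: tliftD.
elim/tens_ind: t => [|s t hs ht|m n].
- by rewrite scaler0; exact/morphD_0/tliftD.
- by rewrite scalerDr tliftD // hs ht addr0.
- by rewrite -tpureZl (tlift_pure fDl fDr fZ) /f zclsZ_horner hornerX tpureZl scale0r.
Qed.

(** * Algebras presented by generators in a module *)

Section PresentedAlgebra.
Variables (R : comNzRingType) (M : lmodType R) (S : talg M -> Prop).
Local Notation Q := (alg_quot S).

Definition pgen (x : M) : Q := acls S (talg_gen x).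

Lemma pgenD : {morph pgen : x y / x + y}.
Proof.
by move=> x y; rewrite /pgen -aclsD -taclsD; congr (acls _ _); apply/taclsP/TT_genD.
Qed.

Lemma pgenZ : scalable pgen.
Proof.
by move=> c x; rewrite /pgen -aclsZ -taclsZ; congr (acls _ _); apply/taclsP/TT_genZ.
Qed.

Lemma aclsM (x y : talg M) : acls S (amul x y) = amul (acls S x) (acls S y).
Proof. exact: (esym (aquot_mulE S x y)). Qed.

Lemma aclsB (x y : talg M) : acls S (x - y) = acls S x - acls S y.
Proof. exact: (qclsB (ideal_sub S)). Qed.

Lemma acls_rel x : S x -> acls S x = 0.
Proof. by move=> Sx; apply/aclsP; rewrite subr0; exact: IG_gen. Qed.

Lemma presented_ind (P : Q -> Prop) :
  (forall r, P (r *: aone)) -> (forall x, P (pgen x)) ->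
  (forall s t, P s -> P t -> P (s + t)) ->
  (forall s t, P s -> P t -> P (amul s t)) ->
  forall t, P t.
Proof.
move=> P1 Pg PD PM t; have [x ->] := acls_surj t; have [y ->] := tacls_surj x.
elim: y => [r|m|y IHy y' IHy'|y IHy y' IHy'].
- have -> : tacls (TScal M r) = r *: (aone : talg M).
    rewrite -[RHS]taclsZ; apply/taclsP.
    by have := TT_scalM M r 1; rewrite mulr1.
  by rewrite aclsZ; exact: P1.
- exact: Pg.
- by rewrite taclsD aclsD; exact: PD.
- have -> : tacls (TMul y y') = amul (tacls y) (tacls y').
    exact: (esym (talg_mulE y y')).
  by rewrite aclsM; exact: PM.
Qed.

Section Lift.
Variables (K : comNzRingType) (A : assocAlgType K) (rho : {rmorphism R -> K}).
Variable f : M -> A.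
Local Notation s := (fun r => rho r *: (aone : A)).

Hypothesis fD : {morph f : x y / x + y}.
Hypothesis fZ : forall r m, f (r *: m) = rho r *: f m.

Lemma talg_lift_tacls x : talg_lift s f (tacls x) = tterm_eval s f x.
Proof.
apply: talg_lift_cls => //.
- by rewrite rmorph0 scale0r.
- by rewrite rmorph1 scale1r.
- by move=> a b; rewrite rmorphD scalerDl.
- by move=> a b; rewrite amulZl amulZr amul1l rmorphM scalerA.
- by move=> r a; rewrite amulZl amulZr amul1l amul1r.
- by move=> r m; rewrite fZ amulZl amul1l.
Qed.

Lemma talg_lift_gen m : talg_lift s f (talg_gen m) = f m.
Proof. exact: talg_lift_tacls. Qed.

Lemma talg_lift1 : talg_lift s f aone = aone.
Proof. by rewrite [LHS]talg_lift_tacls /= rmorph1 scale1r. Qed.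

Lemma talg_liftD : {morph talg_lift s f : x y / x + y}.
Proof.
move=> t t'; have [x ->] := tacls_surj t; have [y ->] := tacls_surj t'.
by rewrite -taclsD !talg_lift_tacls.
Qed.

Lemma talg_liftM x y :
  talg_lift s f (amul x y) = amul (talg_lift s f x) (talg_lift s f y).
Proof.
have [x' ->] := tacls_surj x; have [y' ->] := tacls_surj y.
have -> : amul (tacls x') (tacls y') = tacls (TMul x' y') by exact: talg_mulE.
by rewrite !talg_lift_tacls.
Qed.

Lemma talg_liftZ r x : talg_lift s f (r *: x) = rho r *: talg_lift s f x.
Proof.
have [x' ->] := tacls_surj x.
by rewrite -taclsZ !talg_lift_tacls /= amulZl amul1l.
Qed.

Hypothesis fS : forall x, S x -> talg_lift s f x = 0.

(** Universal property of the quotient. The scalar map [rho] is [idfun] for maps over one base ring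
    and evaluation at 0 for the passage from F[z] to F. *)
Definition pres_lift (t : Q) : A := talg_lift s f (repr t).

(** The lift to the tensor algebra is multiplicative, so its kernel is a two-sided ideal; containing
    [S], it contains the ideal generated by [S]. *)
Lemma pres_lift_acls x : pres_lift (acls S x) = talg_lift s f x.
Proof.
have IGP y : ideal_gen S y -> talg_lift s f y = 0.
  elim=> {y} [y|||a y _ IH|a y _ IH]; first exact: fS.
  - exact/morphD_0/talg_liftD.
  - by move=> y y' _ h _ h'; rewrite (morphD_B talg_liftD) h h' subr0.
  - by rewrite talg_liftM IH amulx0.
  - by rewrite talg_liftM IH amul0x.
apply/eqP; rewrite -subr_eq0 -(morphD_B talg_liftD); apply/eqP/IGP.
exact: areprP.
Qed.

Lemma pres_lift_gen m : pres_lift (pgen m) = f m.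
Proof. by rewrite pres_lift_acls talg_lift_gen. Qed.

Lemma pres_lift1 : pres_lift aone = aone.
Proof. by rewrite [LHS]pres_lift_acls talg_lift1. Qed.

Lemma pres_liftD : {morph pres_lift : x y / x + y}.
Proof.
move=> t t'; have [x ->] := acls_surj t; have [y ->] := acls_surj t'.
by rewrite -aclsD !pres_lift_acls talg_liftD.
Qed.

Lemma pres_liftM x y : pres_lift (amul x y) = amul (pres_lift x) (pres_lift y).
Proof.
have [x' ->] := acls_surj x; have [y' ->] := acls_surj y.
by rewrite -aclsM !pres_lift_acls talg_liftM.
Qed.

Lemma pres_liftZ r x : pres_lift (r *: x) = rho r *: pres_lift x.
Proof.
by have [x' ->] := acls_surj x; rewrite -aclsZ !pres_lift_acls talg_liftZ.
Qed.

End Lift.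

End PresentedAlgebra.

(** * Base change of presented algebras to the zero fiber *)

Section PresentedBaseChange.
Variables (F : comNzRingType) (M : lmodType {poly F}).
Variables (S : talg M -> Prop) (S0 : talg (zfib M) -> Prop).
Local Notation Q := (alg_quot S).
Local Notation Q0 := (alg_quot S0).

(** [fiber_gen] and [gen_fiber] are the generator maps inducing base change [Q0 -> zfib Q] and its
    inverse; the second is semilinear along evaluation at z = 0. *)
Definition fiber_gen (x : zfib M) : zfib Q := zcls (pgen S (repr x)).
Definition gen_fiber (x : M) : Q0 := pgen S0 (zcls x).

Lemma fiber_gen_zcls x : fiber_gen (zcls x) = zcls (pgen S x).
Proof.
apply: (@zfib_descend _ _ _ (fun x => zcls (pgen S x))) => [y y'|y].
  by rewrite pgenD zclsD.
by rewrite pgenZ zclsZ_horner hornerX scale0r.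
Qed.

Lemma fiber_genD : {morph fiber_gen : x y / x + y}.
Proof.
move=> t t'; have [x ->] := zcls_surj t; have [y ->] := zcls_surj t'.
by rewrite -zclsD !fiber_gen_zcls pgenD zclsD.
Qed.

Lemma fiber_genZ : scalable fiber_gen.
Proof.
move=> c t; have [x ->] := zcls_surj t.
by rewrite -zclsZ !fiber_gen_zcls pgenZ zclsZ.
Qed.

Lemma gen_fiberD : {morph gen_fiber : x y / x + y}.
Proof. by move=> x y; rewrite /gen_fiber zclsD pgenD. Qed.

Lemma gen_fiberZ (f : {poly F}) x :
  gen_fiber (f *: x) = horner_eval 0 f *: gen_fiber x.
Proof. by rewrite /gen_fiber zclsZ_horner pgenZ. Qed.

Hypothesis hS0 : forall t, S0 t ->
  talg_lift (fun c => idfun c *: (aone : zfib Q)) fiber_gen t = 0.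
Hypothesis hS : forall t, S t ->
  talg_lift (fun f => horner_eval 0 f *: (aone : Q0)) gen_fiber t = 0.

Let lift : Q -> Q0 := pres_lift (horner_eval 0) gen_fiber.

Definition base_change_inv (u : zfib Q) : Q0 :=
  pres_lift (horner_eval 0) gen_fiber (repr u).

Lemma base_change_inv_zcls t :
  base_change_inv (zcls t) = pres_lift (horner_eval 0) gen_fiber t.
Proof.
apply: (@zfib_descend _ _ _ lift) => [x y|x].
  exact: (pres_liftD gen_fiberD gen_fiberZ hS).
rewrite /lift (pres_liftZ gen_fiberD gen_fiberZ hS).
by rewrite /= /horner_eval hornerX scale0r.
Qed.

Lemma base_change_inv_gen x : base_change_inv (zcls (pgen S x)) = pgen S0 (zcls x).
Proof.
by rewrite base_change_inv_zcls (pres_lift_gen gen_fiberD gen_fiberZ hS).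
Qed.

Lemma base_change_invD : {morph base_change_inv : x y / x + y}.
Proof.
move=> t t'; have [x ->] := zcls_surj t; have [y ->] := zcls_surj t'.
rewrite -zclsD !base_change_inv_zcls.
exact: (pres_liftD gen_fiberD gen_fiberZ hS).
Qed.

Lemma base_change_invZ : scalable base_change_inv.
Proof.
move=> c t; have [x ->] := zcls_surj t; rewrite -zclsZ !base_change_inv_zcls.
by rewrite (pres_liftZ gen_fiberD gen_fiberZ hS) /= /horner_eval hornerC.
Qed.

Let bcD := pres_liftD fiber_genD (fiber_genZ : forall r m, _ = idfun r *: _) hS0.
Let bcM := pres_liftM fiber_genD (fiber_genZ : forall r m, _ = idfun r *: _) hS0.
Let bcZ := pres_liftZ fiber_genD (fiber_genZ : forall r m, _ = idfun r *: _) hS0.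
Let bc1 := pres_lift1 fiber_genD (fiber_genZ : forall r m, _ = idfun r *: _) hS0.
Let bcg := pres_lift_gen fiber_genD (fiber_genZ : forall r m, _ = idfun r *: _) hS0.

Lemma base_changeK : cancel (pres_lift idfun fiber_gen) base_change_inv.
Proof.
elim/presented_ind => [r|x|s t IHs IHt|s t IHs IHt].
- rewrite bcZ bc1 base_change_invZ; congr (_ *: _).
  rewrite base_change_inv_zcls.
  exact: (pres_lift1 gen_fiberD gen_fiberZ hS).
- rewrite bcg; have [y ->] := zcls_surj x.
  by rewrite fiber_gen_zcls base_change_inv_gen.
- by rewrite bcD base_change_invD IHs IHt.
(* Multiplicativity of [base_change_inv] is available only on explicit classes, hence the passage to
   [zcls x] and [zcls y]. *)
- rewrite bcM -{2}IHs -{2}IHt.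
  have [x ->] := zcls_surj (pres_lift idfun fiber_gen s).
  have [y ->] := zcls_surj (pres_lift idfun fiber_gen t).
  have -> : amul (zcls x) (zcls y) = zcls (amul x y) by exact: zfib_mulE.
  by rewrite !base_change_inv_zcls (pres_liftM gen_fiberD gen_fiberZ hS).
Qed.

Lemma base_change_invK : cancel base_change_inv (pres_lift idfun fiber_gen).
Proof.
move=> u; have [t ->] := zcls_surj u; rewrite base_change_inv_zcls.
elim/presented_ind: t => [r|x|s t IHs IHt|s t IHs IHt].
- rewrite (pres_liftZ gen_fiberD gen_fiberZ hS) (pres_lift1 gen_fiberD gen_fiberZ hS).
  by rewrite bcZ bc1 zclsZ_horner.
- by rewrite (pres_lift_gen gen_fiberD gen_fiberZ hS) bcg fiber_gen_zcls.
- by rewrite (pres_liftD gen_fiberD gen_fiberZ hS) bcD IHs IHt zclsD.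
- rewrite (pres_liftM gen_fiberD gen_fiberZ hS) bcM IHs IHt; exact: zfib_mulE.
Qed.

Lemma inverse_base_change :
  inverse_map (pres_lift idfun fiber_gen) =1 base_change_inv.
Proof. exact: inverse_map_cancel base_changeK base_change_invK. Qed.

End PresentedBaseChange.

(** * Functoriality and base change *)

Section EnvelopingRelation.
Variables (R K : comNzRingType) (L : lieAlgType R) (A : assocAlgType K).
Variables (rho : {rmorphism R -> K}) (f : L -> A).
Hypothesis fD : {morph f : x y / x + y}.
Hypothesis fZ : forall r m, f (r *: m) = rho r *: f m.

Lemma talg_lift_uenv_rel :
  (forall x y, f (lie x y) = amul (f x) (f y) - amul (f y) (f x)) ->
  forall t, uenv_rel t -> talg_lift (fun r => rho r *: (aone : A)) f t = 0.
Proof.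
move=> flie _ [x y]; rewrite !(morphD_B (talg_liftD fD fZ)).
by rewrite !(talg_liftM fD fZ) !(talg_lift_gen fD fZ) flie subrr.
Qed.

End EnvelopingRelation.

Lemma uenv_gen_lie (R : comNzRingType) (L : lieAlgType R) (x y : L) :
  uenv_gen (lie x y)
  = amul (uenv_gen x) (uenv_gen y) - amul (uenv_gen y) (uenv_gen x).
Proof.
have := acls_rel (UenvRel x y); rewrite !aclsB !aclsM => /eqP.
by rewrite subr_eq0 => /eqP.
Qed.

Section CliffordRelation.
Variables (R K : comNzRingType) (M : lmodType R) (B : M -> M -> R).
Variables (A : assocAlgType K) (rho : {rmorphism R -> K}) (f : M -> A).
Hypothesis fD : {morph f : x y / x + y}.
Hypothesis fZ : forall r m, f (r *: m) = rho r *: f m.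

Lemma talg_lift_cliff_rel :
  (forall x y, amul (f x) (f y) + amul (f y) (f x) = rho (B x y) *: aone) ->
  forall t, cliff_rel B t -> talg_lift (fun r => rho r *: (aone : A)) f t = 0.
Proof.
move=> fB _ [x y]; rewrite (morphD_B (talg_liftD fD fZ)) (talg_liftD fD fZ).
rewrite !(talg_liftM fD fZ) !(talg_lift_gen fD fZ) fB.
by rewrite (talg_liftZ fD fZ) (talg_lift1 fD fZ) subrr.
Qed.

End CliffordRelation.

Lemma cliff_gen_anticomm (R : comNzRingType) (M : lmodType R) (B : M -> M -> R)
    (x y : M) :
  amul (cliff_gen B x) (cliff_gen B y) + amul (cliff_gen B y) (cliff_gen B x)
  = B x y *: aone.
Proof.
have := acls_rel (CliffRel B x y); rewrite aclsB aclsD !aclsM aclsZ => /eqP.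
by rewrite subr_eq0 => /eqP.
Qed.

Section FunctorialMapTheory.
Variable R : comNzRingType.

Section Uenv.
Variables (L L' : lieAlgType R) (f : L -> L').
Hypothesis fD : {morph f : x y / x + y}.
Hypothesis fZ : scalable f.
Hypothesis flie : forall x y, f (lie x y) = lie (f x) (f y).

Let fgD : {morph (fun x => uenv_gen (f x)) : x y / x + y}.
Proof. by move=> x y; rewrite fD; exact: pgenD. Qed.
Let fgZ r x : uenv_gen (f (r *: x)) = idfun r *: uenv_gen (f x).
Proof. by rewrite fZ; exact: pgenZ. Qed.
Let fgS := talg_lift_uenv_rel fgD fgZ
  (fun x y => etrans (congr1 _ (flie x y)) (uenv_gen_lie _ _)).

Lemma uenv_map_gen x : uenv_map f (uenv_gen x) = uenv_gen (f x).
Proof. exact: (pres_lift_gen fgD fgZ fgS). Qed.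
Lemma uenv_mapD : {morph uenv_map f : x y / x + y}.
Proof. exact: (pres_liftD fgD fgZ fgS). Qed.
Lemma uenv_mapZ : scalable (uenv_map f).
Proof. exact: (pres_liftZ fgD fgZ fgS). Qed.

End Uenv.

Section Cliff.
Variables (M M' : lmodType R) (B : M -> M -> R) (B' : M' -> M' -> R).
Variable f : M -> M'.
Hypothesis fD : {morph f : x y / x + y}.
Hypothesis fZ : scalable f.
Hypothesis fB : forall x y, B' (f x) (f y) = B x y.

Let fgD : {morph (fun x => cliff_gen B' (f x)) : x y / x + y}.
Proof. by move=> x y; rewrite fD; exact: pgenD. Qed.
Let fgZ r x : cliff_gen B' (f (r *: x)) = idfun r *: cliff_gen B' (f x).
Proof. by rewrite fZ; exact: pgenZ. Qed.
Let fgS : forall t, cliff_rel B t -> talg_lift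
  (fun r => idfun r *: (aone : cliff B')) (fun x => cliff_gen B' (f x)) t = 0.
Proof.
by apply: (talg_lift_cliff_rel fgD fgZ) => x y; rewrite cliff_gen_anticomm fB.
Qed.

Lemma cliff_map_gen x :
  cliff_map B' f (cliff_gen B x) = cliff_gen B' (f x).
Proof. exact: (pres_lift_gen fgD fgZ fgS). Qed.
Lemma cliff_mapD : {morph @cliff_map R M M' B B' f : x y / x + y}.
Proof. exact: (pres_liftD fgD fgZ fgS). Qed.
Lemma cliff_mapZ : scalable (@cliff_map R M M' B B' f).
Proof. exact: (pres_liftZ fgD fgZ fgS). Qed.

End Cliff.

End FunctorialMapTheory.

Section BaseChangeTheory.
Variable F : comNzRingType.

Section Uenv.
Variable L : lieAlgType {poly F}.

Let hS0 : forall t, @uenv_rel F (zfib L) t ->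
  talg_lift (fun c => idfun c *: aone) (@fiber_gen F L (@uenv_rel _ L)) t = 0.
Proof.
apply: talg_lift_uenv_rel; [exact: fiber_genD|exact: fiber_genZ|].
move=> s t; have [x ->] := zcls_surj s; have [y ->] := zcls_surj t.
have -> : lie (zcls x) (zcls y) = zcls (lie x y) by exact: zfib_lieE.
rewrite !fiber_gen_zcls.
rewrite -[pgen _ (lie x y)]/(uenv_gen (lie x y)) uenv_gen_lie.
rewrite zclsB.
by congr (_ - _); exact: (esym (zfib_mulE _ _)).
Qed.

Let hS : forall t, @uenv_rel _ L t ->
  talg_lift (fun f => horner_eval 0 f *: aone)
    (@gen_fiber F L (@uenv_rel F (zfib L))) t = 0.
Proof.
apply: talg_lift_uenv_rel; [exact: gen_fiberD|exact: gen_fiberZ|].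
move=> x y; rewrite /gen_fiber.
have -> : zcls (lie x y) = lie (zcls x) (zcls y) by exact: (esym (zfib_lieE _ _)).
exact: (@uenv_gen_lie F (zfib L) (zcls x) (zcls y)).
Qed.

Let uenv_invE : inverse_map (@uenv_base_change F L) =1
  @base_change_inv F L (@uenv_rel _ L) (@uenv_rel F (zfib L)).
Proof. exact: (inverse_base_change hS0 hS). Qed.

Lemma uenv_base_change_inv_gen x :
  inverse_map (@uenv_base_change F L) (zcls (uenv_gen x)) = uenv_gen (zcls x).
Proof. by rewrite uenv_invE; exact: (base_change_inv_gen hS). Qed.
Lemma uenv_base_change_invD :
  {morph inverse_map (@uenv_base_change F L) : x y / x + y}.
Proof. by move=> x y; rewrite !uenv_invE; exact: (base_change_invD hS). Qed.
Lemma uenv_base_change_invZ : scalable (inverse_map (@uenv_base_change F L)).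
Proof. by move=> c x; rewrite !uenv_invE; exact: (base_change_invZ hS). Qed.

End Uenv.

Section Cliff.
Variables (M : lmodType {poly F}) (B : M -> M -> {poly F}).
Hypothesis Bl : forall y, linear (B^~ y : M -> {poly F}^o).
Hypothesis Br : forall x, linear (B x : M -> {poly F}^o).

(** Changing one argument by a multiple of z changes [B] by a multiple of z, which vanishes at 0;
    this is applied to each variable in turn. *)
Lemma zfib_form_zcls x y : zfib_form B (zcls x) (zcls y) = (B x y).[0].
Proof.
have BDl z u v : B (u + v) z = B u z + B v z.
  by have := Bl z 1 u v; rewrite !scale1r.
have BDr z u v : B z (u + v) = B z u + B z v.
  by have := Br z 1 u v; rewrite !scale1r.
have B0l z : B 0 z = 0 by apply: (addrI (B 0 z)); rewrite -BDl !addr0.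
have B0r z : B z 0 = 0 by apply: (addrI (B z 0)); rewrite -BDr !addr0.
have BXl z u : (B ('X *: u) z).[0] = 0.
  by have := Bl z 'X u 0; rewrite B0l !addr0 => ->; rewrite hornerM hornerX mul0r.
have BXr z u : (B z ('X *: u)).[0] = 0.
  by have := Br z 'X u 0; rewrite B0r !addr0 => ->; rewrite hornerM hornerX mul0r.
rewrite /zfib_form (@zfib_descend _ _ _ (fun x => (B x (repr (zcls y))).[0])) //.
  rewrite (@zfib_descend _ _ _ (fun y => (B x y).[0])) // => u v.
  by rewrite BDr hornerD.
by move=> u v; rewrite BDl hornerD.
Qed.

Let S0 := cliff_rel (zfib_form B).

Let hS0 : forall t, S0 t ->
  talg_lift (fun c => idfun c *: aone) (@fiber_gen F M (cliff_rel B)) t = 0.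
Proof.
apply: talg_lift_cliff_rel; [exact: fiber_genD|exact: fiber_genZ|].
move=> s t; have [x ->] := zcls_surj s; have [y ->] := zcls_surj t.
rewrite !fiber_gen_zcls zfib_form_zcls /= -zclsZ_horner -cliff_gen_anticomm zclsD.
by congr (_ + _); exact: zfib_mulE.
Qed.

Let hS : forall t, cliff_rel B t ->
  talg_lift (fun f => horner_eval 0 f *: aone) (@gen_fiber F M S0) t = 0.
Proof.
apply: talg_lift_cliff_rel; [exact: gen_fiberD|exact: gen_fiberZ|].
move=> x y; rewrite [LHS](cliff_gen_anticomm (zfib_form B)).
by rewrite zfib_form_zcls.
Qed.

Let cliff_invE : inverse_map (@cliff_base_change F M B) =1
  @base_change_inv F M (cliff_rel B) S0.
Proof. exact: (inverse_base_change hS0 hS). Qed.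

Lemma cliff_base_change_inv_gen x :
  inverse_map (@cliff_base_change F M B) (zcls (cliff_gen B x))
  = cliff_gen (zfib_form B) (zcls x).
Proof. by rewrite cliff_invE; exact: (base_change_inv_gen hS). Qed.
Lemma cliff_base_change_invD :
  {morph inverse_map (@cliff_base_change F M B) : x y / x + y}.
Proof. by move=> x y; rewrite !cliff_invE; exact: (base_change_invD hS). Qed.
Lemma cliff_base_change_invZ : scalable (inverse_map (@cliff_base_change F M B)).
Proof. by move=> c x; rewrite !cliff_invE; exact: (base_change_invZ hS). Qed.

End Cliff.

End BaseChangeTheory.

(** * The tensor of the identity and dual bases *)

Section IdTensor.
Variables (R : comNzRingType) (P : lmodType R) (b : P -> P -> R).
Hypothesis bl : forall y, linear (b^~ y : P -> R^o).

(* Expanding left factors in [E] gives [w = \sum_i E i (x) contract w (E' i)], *)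
(* so the set from which [id_tensor] chooses is a singleton.                  *)
Lemma id_tensor_dual_basis (n : nat) (E E' : 'I_n -> P) :
  (forall u, u = \sum_i b u (E' i) *: E i) ->
  (forall u, u = \sum_i b (E i) u *: E' i) ->
  id_tensor b = \sum_i tpure (E i) (E' i).
Proof.
move=> expE expE'.
have bDl z u v : b (u + v) z = b u z + b v z.
  by have := bl z 1 u v; rewrite !scale1r.
have bZl z a u : b (a *: u) z = a * b u z.
  have b0 : b 0 z = 0 by apply: (addrI (b 0 z)); rewrite -bDl !addr0.
  by have := bl z a u 0; rewrite b0 !addr0.
have cDl x (m m' n' : P) : b (m + m') x *: n' = b m x *: n' + b m' x *: n'.
  by rewrite bDl scalerDl.
have cDr x (m n' n'' : P) : b m x *: (n' + n'') = b m x *: n' + b m x *: n''.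
  exact: scalerDr.
have cZ x a (m n' : P) : b (a *: m) x *: n' = b m x *: (a *: n').
  by rewrite bZl scalerA mulrC.
have contractD x : {morph (Defs.contract b)^~ x : s t / s + t}.
  by move=> s t; exact: tliftD (cDl x) (cDr x) (cZ x) _ _.
have expand w : w = \sum_i tpure (E i) (Defs.contract b w (E' i)).
  elim/tens_ind: w => [|s t {1}-> {1}->|u v].
  - rewrite big1 // => i _; rewrite (morphD_0 (contractD _)).
    by rewrite -(scale0r (0 : P)) tpureZr scale0r.
  - by rewrite -big_split; apply: eq_bigr => i _; rewrite contractD tpureDr.
  - rewrite {1}(expE u); transitivity (\sum_i tpure (b u (E' i) *: E i) v).
      exact: (big_morph (fun x => tpure x v) (fun x y => tpureDl x y v)
        (morphD_0 (fun x y => tpureDl x y v))).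
    apply: eq_bigr => i _; rewrite tpureZl -tpureZr; congr tpure.
    exact: esym (tlift_pure (cDl _) (cDr _) (cZ _) _ _).
(* Any tensor that [xget] picks contracts to the identity, so [expand] forces it to be the sum; the
   default 0 is excluded because the sum itself qualifies, by [expE']. *)
rewrite /id_tensor; case: xgetP => [w _ /= hw|/(_ (\sum_i tpure (E i) (E' i)))].
  by rewrite [w]expand; apply: eq_bigr => i _; rewrite hw.
case=> x /=; rewrite [RHS]expE'.
exact: tlift_sum (cDl x) (cDr x) (cZ x).
Qed.

Lemma dirac_dual_basis (L : lieAlgType R) (incl : {linear P -> L}) (n : nat)
    (E E' : 'I_n -> P) :
  (forall u, u = \sum_i b u (E' i) *: E i) ->
  (forall u, u = \sum_i b (E i) u *: E' i) ->
  Defs.dirac b incl = \sum_i tpure (uenv_gen (incl (E i))) (cliff_gen b (E' i)).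
Proof.
move=> expE expE'; rewrite /Defs.dirac (id_tensor_dual_basis expE expE').
apply: tlift_sum => [u u' v|u v v'|a u v].
- by rewrite linearD -tpureDl; congr tpure; exact: pgenD.
- by rewrite -tpureDr; congr tpure; exact: pgenD.
- have -> : uenv_gen (incl (a *: u)) = a *: uenv_gen (incl u).
    by rewrite linearZ; exact: pgenZ.
  have -> : cliff_gen b (a *: v) = a *: cliff_gen b v by exact: pgenZ.
  by rewrite tpureZl tpureZr.
Qed.

End IdTensor.

(** * Dual bases of a finite-dimensional space *)

Section DualBasis.
Variables (F : fieldType) (V : vectType F) (b : V -> V -> F).
Hypothesis bl : forall y, linear (b^~ y : V -> F^o).
Hypothesis br : forall x, linear (b x : V -> F^o).
Variables (n : nat) (e e' : n.-tuple V).
Hypothesis he : basis_of fullv e.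
Hypothesis hdual : forall i j : 'I_n, b (tnth e i) (tnth e' j) = (i == j)%:R.

Let b_suml (c : 'I_n -> F) (v : 'I_n -> V) y :
  b (\sum_i c i *: v i) y = \sum_i c i * b (v i) y.
Proof.
have bDl u w : b (u + w) y = b u y + b w y.
  by have := bl y 1 u w; rewrite !scale1r.
have b0l : b 0 y = 0 by apply: (addrI (b 0 y)); rewrite -bDl !addr0.
rewrite (big_morph (b^~ y) bDl b0l); apply: eq_bigr => i _.
by have := bl y (c i) (v i) 0; rewrite b0l !addr0.
Qed.

Let b_sumr (c : 'I_n -> F) (v : 'I_n -> V) y :
  b y (\sum_i c i *: v i) = \sum_i c i * b y (v i).
Proof.
have bDr u w : b y (u + w) = b y u + b y w.
  by have := br y 1 u w; rewrite !scale1r.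
have b0r : b y 0 = 0 by apply: (addrI (b y 0)); rewrite -bDr !addr0.
rewrite (big_morph (b y) bDr b0r); apply: eq_bigr => i _.
by have := br y (c i) (v i) 0; rewrite b0r !addr0.
Qed.

Let sum_delta (c : 'I_n -> F) j : \sum_i c i * (i == j)%:R = c j.
Proof.
rewrite (bigD1 j) //= eqxx mulr1 big1 ?addr0 // => i /negPf ->.
by rewrite mulr0.
Qed.

(** Pairing the expansion of x in [e] with a member of [e'] isolates one coordinate. *)
Lemma dual_basis_expandl x : x = \sum_i b x (tnth e' i) *: tnth e i.
Proof.
have hx := coord_basis he (memvf x); rewrite {1}hx; apply: eq_bigr => i _.
rewrite -tnth_nth; congr (_ *: _).
rewrite {2}hx b_suml -[LHS](sum_delta (fun i => coord e i x) i).
by apply: eq_bigr => j _; rewrite -tnth_nth hdual.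
Qed.

(** Pairing a relation among the members of [e'] with those of [e] shows that [e'] is free; having
    as many members as [e], it is a basis, and coordinates are again read off by pairing. *)
Lemma dual_basis_expandr x : x = \sum_i b (tnth e i) x *: tnth e' i.
Proof.
have free_e' : free e'.
  apply/freeP => c hc i.
  have : b (tnth e i) (\sum_j c j *: e'`_j) = 0.
    by rewrite hc; have := b_sumr (fun=> 0) (fun=> 0) (tnth e i); rewrite !big1 //
      => *; rewrite ?scale0r ?mul0r.
  rewrite b_sumr => <-; rewrite -[LHS](sum_delta c i).
  by apply: eq_bigr => j _; rewrite -tnth_nth hdual eq_sym.
have he' : basis_of fullv e'.
  by rewrite basisEfree free_e' subvf size_tuple (size_basis he) leqnn.
have hx := coord_basis he' (memvf x); rewrite {1}hx; apply: eq_bigr => i _.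
rewrite -tnth_nth; congr (_ *: _).
rewrite {2}hx b_sumr -[LHS](sum_delta (fun i => coord e' i x) i).
by apply: eq_bigr => j _; rewrite -tnth_nth hdual eq_sym.
Qed.

End DualBasis.

(** * The deformation family *)

Section DeformationTheory.
Variables (F : numFieldType) (g : symLieType F).
Local Notation p := (subvs_of (pspace g)).

Lemma theta_vsval (x : p) : theta (vsval x) = - vsval x.
Proof. by apply/eqP; rewrite -memp; exact: subvsP. Qed.

Fact zp_subproof (x : p) : pxpure 'X (vsval x) \in @deform_p_pred F g.
Proof.
by apply/asboolP; rewrite -['X]mulr1; apply: PD_pure; exact: theta_vsval.
Qed.
Definition zp (x : p) : deform_p g := DeformP (zp_subproof x).

Lemma zpD : {morph zp : x y / x + y}.
Proof. by move=> x y; apply: val_inj; rewrite /= pxpureDr. Qed.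

Lemma zpZ c x : zp (c *: x) = c%:P *: zp x.
Proof.
by apply: val_inj; rewrite /= -pxpureZ pxpure_scale mul_polyC.
Qed.

Lemma val_zp f x : val (f *: zp x) = pxpure (f * 'X) (vsval x).
Proof. exact: pxpure_scale. Qed.

Fact deform_incl_linear : linear (@deform_incl F g).
Proof. by move=> c x y; exact: val_inj. Qed.
HB.instance Definition _ := GRing.isLinear.Build {poly F} (deform_p g) (deform g)
  _ (@deform_incl F g) deform_incl_linear.

(** The elements [zp x] generate p_d over F[z]. *)
Lemma deform_p_ind (P : deform_p g -> Prop) :
  P 0 -> (forall u v, P u -> P v -> P (u + v)) ->
  (forall f x, P (f *: zp x)) -> forall u, P u.
Proof.
(* The value of u is generalised so that induction can run on its membership in p_d; the summands
   are then repacked as elements of [deform_p g]. *)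
move=> P0 PD Pz u; have /asboolP := valP u; move: {2 3}(val u) (erefl (val u)).
move=> v huv hv; elim: hv u huv => {v} [f x hx||v w hv IHv hw IHw] u hu.
- have xp : x \in pspace g by rewrite memp hx.
  have -> : u = f *: zp (Subvs xp); last exact: Pz.
  by apply: val_inj; rewrite hu val_zp mulrC.
- by have -> : u = 0 by exact: val_inj.
- have v_in : v \in @deform_p_pred F g by apply/asboolP.
  have w_in : w \in @deform_p_pred F g by apply/asboolP.
  have -> : u = DeformP v_in + DeformP w_in by apply: val_inj.
  by apply: (PD); [exact: IHv | exact: IHw].
Qed.

(** The formula of [eta] on representatives, extended to the constant family. It kills z times the
    deformation family but not z times the constant family: z (x) x with x in p goes to x. *)
Definition kp_jet (u : polyx g) : g :=
  tlift (fun (f : {poly F}) (x : g) => f.[0] *: kproj x + f^`().[0] *: pproj x) u.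

Let jDl (f f' : {poly F}) (x : g) : (f + f').[0] *: kproj x + (f + f')^`().[0] *: pproj x
  = (f.[0] *: kproj x + f^`().[0] *: pproj x)
    + (f'.[0] *: kproj x + f'^`().[0] *: pproj x).
Proof. by rewrite derivD !hornerD !scalerDl addrACA. Qed.
Let jDr (f : {poly F}) (x x' : g) : f.[0] *: kproj (x + x') + f^`().[0] *: pproj (x + x')
  = (f.[0] *: kproj x + f^`().[0] *: pproj x)
    + (f.[0] *: kproj x' + f^`().[0] *: pproj x').
Proof. by rewrite kprojD pprojD !scalerDr addrACA. Qed.
Let jZ c (f : {poly F}) (x : g) : (c *: f).[0] *: kproj x + (c *: f)^`().[0] *: pproj x
  = f.[0] *: kproj (c *: x) + f^`().[0] *: pproj (c *: x).
Proof. by rewrite derivZ !hornerZ kprojZ pprojZ !scalerA ![c * _]mulrC. Qed.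

Lemma kp_jet_pure f x :
  kp_jet (pxpure f x) = f.[0] *: kproj x + f^`().[0] *: pproj x.
Proof. exact: pxlift_pure jDl jDr jZ _ _. Qed.
Lemma kp_jetD : {morph kp_jet : u v / u + v}.
Proof. exact: pxliftD jDl jDr jZ. Qed.

Lemma kp_jetZ c u : kp_jet (c%:P *: u) = c *: kp_jet u.
Proof.
elim/px_ind: u => [|u v hu hv|f x].
- by rewrite scaler0 (morphD_0 kp_jetD) scaler0.
- by rewrite scalerDr !kp_jetD hu hv scalerDr.
- by rewrite pxpure_scale mul_polyC !kp_jet_pure derivZ !hornerZ scalerDr !scalerA.
Qed.

Lemma kp_jet_kd f x : theta x = x -> kp_jet (pxpure f x) = f.[0] *: x.
Proof. by move=> hx; rewrite kp_jet_pure kproj_id // pproj_0 // scaler0 addr0. Qed.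

Lemma kp_jet_pd f x : theta x = - x -> kp_jet (pxpure ('X * f) x) = f.[0] *: x.
Proof.
move=> hx; rewrite kp_jet_pure kproj_0 // pproj_id // scaler0 add0r.
by rewrite derivM derivX hornerD !hornerM hornerX mul0r addr0 hornerC mul1r.
Qed.

Lemma deform_elim (P : polyx g -> Prop) :
  P 0 -> (forall u v, P u -> P v -> P (u + v)) ->
  (forall f x, theta x = x -> P (pxpure f x)) ->
  (forall f x, theta x = - x -> P (pxpure ('X * f) x)) ->
  forall u : deform g, P (val u).
Proof.
move=> P0 PD Pk Pp u; have /asboolP [v [w [hv hw ->]]] := valP u.
apply: (PD).
- by elim: hv => [f x /Pk||s t _ Ps _ Pt] //; exact: PD.
- by elim: hw => [f x /Pp||s t _ Ps _ Pt] //; exact: PD.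
Qed.

Lemma eta_zcls (u : deform g) : eta (zcls u) = kp_jet (val u).
Proof.
apply: (@zfib_descend _ _ _ (fun u : deform g => kp_jet (val u))) => [v w|v].
  exact: kp_jetD.
have -> : val ('X *: v) = 'X *: val v by [].
elim/deform_elim: {v}(val v) => [|v w hv hw|f x hx|f x hx].
- by rewrite scaler0 (morphD_0 kp_jetD).
- by rewrite scalerDr kp_jetD hv hw addr0.
- by rewrite pxpure_scale kp_jet_kd // hornerM hornerX mul0r scale0r.
- by rewrite pxpure_scale kp_jet_pd // hornerM hornerX mul0r scale0r.
Qed.

Lemma etaD : {morph @eta F g : x y / x + y}.
Proof.
move=> s t; have [u ->] := zcls_surj s; have [v ->] := zcls_surj t.
by rewrite -zclsD !eta_zcls; exact: kp_jetD.
Qed.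

Lemma etaZ : scalable (@eta F g).
Proof.
move=> c t; have [u ->] := zcls_surj t.
by rewrite -zclsZ !eta_zcls; exact: kp_jetZ.
Qed.

Lemma motion_lie_kp (x y : g) : theta x = x -> theta y = - y ->
  motion_lie x y = lie x y.
Proof.
move=> hx hy; rewrite /motion_lie kproj_id // pproj_id // kproj_0 //.
by rewrite pproj_0 // lie0x liex0 !addr0.
Qed.

(** Checked on generators. For k with k and k with p, the values at 0 of the coefficients multiply.
    For p with p, the bracket lies in z^2 F[z] (x) k, whose jet is 0, and the motion bracket of two
    elements of p is also 0. *)
Lemma kp_jet_lie (u v : deform g) :
  kp_jet (lie (val u) (val v)) = motion_lie (kp_jet (val u)) (kp_jet (val v)).
Proof.
have mDl (a b c : g) : motion_lie (a + b) c = motion_lie a c + motion_lie b c.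
  exact: (@lieDl F (motion g)).
have mDr (a b c : g) : motion_lie a (b + c) = motion_lie a b + motion_lie a c.
  exact: (@lieDr F (motion g)).
have m0l (a : g) : motion_lie 0 a = 0 by exact: (@lie0x F (motion g)).
have m0r (a : g) : motion_lie a 0 = 0 by exact: (@liex0 F (motion g)).
have mZl c (a b : g) : motion_lie (c *: a) b = c *: motion_lie a b.
  exact: (@lieZl F (motion g)).
have mZr c (a b : g) : motion_lie a (c *: b) = c *: motion_lie a b.
  exact: (@lieZr F (motion g)).
have mC (a b : g) : motion_lie a b = - motion_lie b a.
  exact: (@lieC F (motion g)).
have j0 := morphD_0 kp_jetD.
have lie_pure f h (x y : g) :
    lie (pxpure f x) (pxpure h y) = pxpure (f * h) (lie x y).
  exact: px_lie_pure.
elim/deform_elim: {u}(val u) => [|u u' IH IH'|f x hx|f x hx].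
- by rewrite lie0x j0 m0l.
- by rewrite lieDl !kp_jetD mDl IH IH'.
- elim/deform_elim: {v}(val v) => [|v v' IH IH'|h y hy|h y hy].
  + by rewrite liex0 j0 m0r.
  + by rewrite lieDr !kp_jetD mDr IH IH'.
  + rewrite lie_pure !kp_jet_kd //; last by rewrite theta_lie hx hy.
    rewrite mZl mZr scalerA hornerM /motion_lie !kproj_id // !pproj_0 //.
    by rewrite lie0x liex0 !add0r.
  + rewrite lie_pure mulrCA (kp_jet_kd _ hx) !kp_jet_pd //.
      by rewrite mZl mZr scalerA hornerM motion_lie_kp.
    by rewrite theta_lie hx hy lieNr.
- elim/deform_elim: {v}(val v) => [|v v' IH IH'|h y hy|h y hy].
  + by rewrite liex0 j0 m0r.
  + by rewrite lieDr !kp_jetD mDr IH IH'.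
  + rewrite lie_pure -mulrA (kp_jet_kd _ hy) !kp_jet_pd //.
      by rewrite mZl mZr scalerA hornerM mC motion_lie_kp // [lie x y]lieC.
    by rewrite theta_lie hx hy lieNl.
  + have hxy : theta (lie x y) = lie x y.
      by rewrite theta_lie hx hy lieNl lieNr opprK.
    rewrite lie_pure (kp_jet_kd _ hxy) !kp_jet_pd // mZl mZr !hornerM hornerX.
    rewrite !mul0r scale0r.
    rewrite /motion_lie !kproj_0 // !lie0x.
    by rewrite liex0 !addr0 !scaler0.
Qed.

Lemma eta_lie (x y : zfib (deform g)) : eta (lie x y) = lie (eta x) (eta y).
Proof.
have [u ->] := zcls_surj x; have [v ->] := zcls_surj y.
have -> : lie (zcls u) (zcls v) = zcls (lie u v) by exact: zfib_lieE.
by rewrite !eta_zcls; exact: kp_jet_lie.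
Qed.

Lemma eta_zp x : eta (zcls (deform_incl (zp x))) = motion_incl x.
Proof.
rewrite eta_zcls /= -['X]mulr1 kp_jet_pd; last exact: theta_vsval.
by rewrite hornerC scale1r.
Qed.

Let cDl (f f' : {poly F}) (x : g) : (f + f')`_1 *: x = f`_1 *: x + f'`_1 *: x.
Proof. by rewrite coefD scalerDl. Qed.
Let cDr (f : {poly F}) (x x' : g) : f`_1 *: (x + x') = f`_1 *: x + f`_1 *: x'.
Proof. exact: scalerDr. Qed.
Let cZ c (f : {poly F}) (x : g) : (c *: f)`_1 *: x = f`_1 *: (c *: x).
Proof. by rewrite coefZ scalerA mulrC. Qed.

(** Elements of z p_d involve only polynomials divisible by z^2, so their coefficient of z
    vanishes. *)
Lemma isom_pE (u : deform_p g) :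
  isom_p (zcls u) = vsproj (pspace g)
    (tlift (fun (f : {poly F}) (x : g) => f`_1 *: x) (val u)).
Proof.
pose phi (u : deform_p g) : p :=
  vsproj (pspace g) (tlift (fun (f : {poly F}) (x : g) => f`_1 *: x) (val u)).
have phiD : {morph phi : u v / u + v}.
  by move=> v w; rewrite /phi [val _]/(val v + val w) (pxliftD cDl cDr cZ) linearD.
apply: (@zfib_descend _ _ _ phi) => // v.
elim/deform_p_ind: v => [|v w hv hw|f x].
- by rewrite scaler0 (morphD_0 phiD).
- by rewrite scalerDr phiD hv hw addr0.
- rewrite /phi scalerA val_zp.
  by rewrite (pxlift_pure cDl cDr cZ) coefMX /= coefXM /= scale0r linear0.
Qed.

Lemma isom_pD : {morph @isom_p F g : x y / x + y}.
Proof.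
move=> s t; have [u ->] := zcls_surj s; have [v ->] := zcls_surj t.
by rewrite -zclsD !isom_pE [val _]/(val u + val v) (pxliftD cDl cDr cZ) linearD.
Qed.

Lemma isom_p_zp f x : isom_p (zcls (f *: zp x)) = f.[0] *: x.
Proof.
rewrite isom_pE val_zp.
by rewrite (pxlift_pure cDl cDr cZ) coefMX /= horner_coef0 linearZ /= vsvalK.
Qed.

Lemma isom_pZ : scalable (@isom_p F g).
Proof.
move=> c t; have [u ->] := zcls_surj t.
rewrite -zclsZ; elim/deform_p_ind: u => [|u v hu hv|f x].
- by rewrite scaler0 [zcls _](qcls0 (zmul_sub _)) (morphD_0 isom_pD) scaler0.
- by rewrite scalerDr !zclsD !isom_pD hu hv scalerDr.
- by rewrite scalerA !isom_p_zp hornerM hornerC scalerA.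
Qed.

End DeformationTheory.

(** * The rescaled form on p_d *)

Section DeformationForm.
Variables (F : numFieldType) (g : symLieType F) (beta : g -> g -> F).
Hypothesis betal : forall y, linear (beta^~ y : g -> F^o).
Hypothesis betar : forall x, linear (beta x : g -> F^o).
Local Notation p := (subvs_of (pspace g)).

Let b (x y : g) : {poly F}^o := (beta x y)%:P.
Let bl y a u v : b (a *: u + v) y = a%:P *: b u y + b v y.
Proof. by rewrite /b; have /= -> := betal y a u v; rewrite polyCD polyCM. Qed.
Let br x a u v : b x (a *: u + v) = a%:P *: b x u + b x v.
Proof. by rewrite /b; have /= -> := betar x a u v; rewrite polyCD polyCM. Qed.

Let ext (u v : deform_p g) : {poly F} := px_ext b (val u) (val v).

Let extDl u v w : ext (u + v) w = ext u w + ext v w.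
Proof. exact: (px_extDl bl br). Qed.
Let extDr u v w : ext u (v + w) = ext u v + ext u w.
Proof. exact: (px_extDr bl br). Qed.
Let extZl f u v : ext (f *: u) v = f * ext u v.
Proof. exact: (px_extZl bl br). Qed.
Let extZr f u v : ext u (f *: v) = f * ext u v.
Proof. exact: (px_extZr bl br). Qed.
Let ext_zp x y : ext (zp x) (zp y) = 'X^2 * (beta0 beta x y)%:P.
Proof. exact: (px_ext_pure bl br). Qed.

(** By F[z]-bilinearity it is enough that [ext] has the factor z^2 on the generators [zp x].
    Exactness of the division in [beta_d] is what makes it commute with multiplication by
    polynomials. *)
Let dvd_ext u v : 'X^2 %| ext u v.
Proof.
elim/deform_p_ind: u => [|u u' h h'|f x].
- by rewrite (morphD_0 (fun u w => extDl u w v)) dvdp0.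
- by rewrite extDl dvdp_add.
elim/deform_p_ind: v => [|v v' h h'|h y].
- by rewrite (morphD_0 (extDr _)) dvdp0.
- by rewrite extDr dvdp_add.
- by rewrite extZl extZr ext_zp; do 2!apply: dvdp_mull; exact: dvdp_mulIl.
Qed.

Lemma beta_d_linearl v : linear ((beta_d beta)^~ v : deform_p g -> {poly F}^o).
Proof.
move=> f u u'; rewrite /beta_d -!/(ext _ _) extDl extZl divpD.
by rewrite -divp_mulA.
Qed.

Lemma beta_d_linearr u : linear (beta_d beta u : deform_p g -> {poly F}^o).
Proof.
move=> f v v'; rewrite /beta_d -!/(ext _ _) extDr extZr divpD.
by rewrite -divp_mulA.
Qed.

(** The factors z of the two arguments cancel the z^2 in the definition of [beta_d]; hence bases
    dual for [beta0] stay dual after [zp]. *)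
Lemma beta_d_zp f h x y :
  beta_d beta (f *: zp x) (h *: zp y) = f * h * (beta0 beta x y)%:P.
Proof.
rewrite /beta_d -/(ext _ _) extZl extZr ext_zp mulrA mulrCA mulKp //.
by rewrite expf_neq0 // polyX_eq0.
Qed.

Lemma beta0_linearl y : linear ((beta0 beta)^~ y : p -> F^o).
Proof. by move=> a u v; rewrite /beta0 linearP; exact: betal. Qed.
Lemma beta0_linearr x : linear (beta0 beta x : p -> F^o).
Proof. by move=> a u v; rewrite /beta0 linearP; exact: betar. Qed.

(** By biadditivity the arguments may be taken to be the classes of [f *: zp x] and [h *: zp y],
    where both sides are f(0) h(0) beta0(x, y). *)
Lemma isom_p_isometry s t :
  beta0 beta (isom_p s) (isom_p t) = zfib_form (beta_d beta) s t.
Proof.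
have [u ->] := zcls_surj s; have [v ->] := zcls_surj t.
rewrite (zfib_form_zcls beta_d_linearl beta_d_linearr).
have B0Dl y : {morph (beta0 beta)^~ y : x x' / x + x'}.
  by move=> x x'; have := beta0_linearl y 1 x x'; rewrite !scale1r.
have B0Dr x : {morph (beta0 beta) x : y y' / y + y'}.
  by move=> y y'; have := beta0_linearr x 1 y y'; rewrite !scale1r.
have BDl v' : {morph (beta_d beta)^~ v' : x x' / x + x'}.
  by move=> x x'; have := beta_d_linearl v' 1 x x'; rewrite !scale1r.
have BDr u' : {morph (beta_d beta) u' : y y' / y + y'}.
  by move=> y y'; have := beta_d_linearr u' 1 y y'; rewrite !scale1r.
have z0 : isom_p (zcls (0 : deform_p g)) = 0 by exact: (morphD_0 (@isom_pD F g)).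
elim/deform_p_ind: u => [|u u' IH IH'|f x].
- by rewrite z0 (morphD_0 (B0Dl _)) (morphD_0 (BDl _)) horner0.
- by rewrite zclsD isom_pD B0Dl BDl hornerD IH IH'.
elim/deform_p_ind: v => [|v v' IH IH'|h y].
- by rewrite z0 (morphD_0 (B0Dr _)) (morphD_0 (BDr _)) horner0.
- by rewrite zclsD isom_pD B0Dr BDr hornerD IH IH'.
rewrite !isom_p_zp beta_d_zp !hornerM hornerC.
have B0Zl a z z' : beta0 beta (a *: z) z' = a * beta0 beta z z'.
  by have := beta0_linearl z' a z 0; rewrite (morphD_0 (B0Dl _)) !addr0.
have B0Zr a z z' : beta0 beta z' (a *: z) = a * beta0 beta z' z.
  by have := beta0_linearr z' a z 0; rewrite (morphD_0 (B0Dr _)) !addr0.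
by rewrite B0Zl B0Zr mulrA.
Qed.

(** * The Dirac operator of the family and its image *)

Section DiracOperator.
Variables (m : nat) (e e' : m.-tuple p).
Hypothesis he : basis_of fullv e.
Hypothesis hdual : forall i j : 'I_m,
  beta0 beta (tnth e i) (tnth e' j) = (i == j)%:R.

(** The expansion of x in p_0 is transported by [zp] and multiplied by f; its coefficients reappear
    as constant polynomials through [beta_d_zp]. *)
Lemma zp_expandl u :
  u = \sum_i beta_d beta u (zp (tnth e' i)) *: zp (tnth e i).
Proof.
have BDl v : {morph (beta_d beta)^~ v : x x' / x + x'}.
  by move=> x x'; have := beta_d_linearl v 1 x x'; rewrite !scale1r.
elim/deform_p_ind: u => [|u u' {1}-> {1}->|f x].
- by rewrite big1 // => i _; rewrite (morphD_0 (BDl _)) scale0r.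
- by rewrite -big_split; apply: eq_bigr => i _; rewrite BDl scalerDl.
rewrite {1}(dual_basis_expandl beta0_linearl he hdual x).
rewrite (big_morph (@zp F g) (@zpD F g) (morphD_0 (@zpD F g))) scaler_sumr.
apply: eq_bigr => i _; rewrite zpZ scalerA -[zp (tnth e' i)]scale1r beta_d_zp.
by rewrite mulr1.
Qed.

Lemma zp_expandr u :
  u = \sum_i beta_d beta (zp (tnth e i)) u *: zp (tnth e' i).
Proof.
have BDr v : {morph (beta_d beta) v : x x' / x + x'}.
  by move=> x x'; have := beta_d_linearr v 1 x x'; rewrite !scale1r.
elim/deform_p_ind: u => [|u u' {1}-> {1}->|f x].
- by rewrite big1 // => i _; rewrite (morphD_0 (BDr _)) scale0r.
- by rewrite -big_split; apply: eq_bigr => i _; rewrite BDr scalerDl.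
rewrite {1}(dual_basis_expandr beta0_linearr he hdual x).
rewrite (big_morph (@zp F g) (@zpD F g) (morphD_0 (@zpD F g))) scaler_sumr.
apply: eq_bigr => i _; rewrite zpZ scalerA -[zp (tnth e i)]scale1r beta_d_zp.
by rewrite mul1r.
Qed.

Lemma dirac_dE : dirac_d beta = \sum_i
  tpure (uenv_gen (deform_incl (zp (tnth e i))))
        (cliff_gen (beta_d beta) (zp (tnth e' i))).
Proof.
pose incl : {linear deform_p g -> deform g} := @deform_incl F g.
exact: (dirac_dual_basis beta_d_linearl incl zp_expandl zp_expandr).
Qed.

(** After [dirac_dE], only the values of [Phi_U] and [Phi_Cl] on generators matter; the linearity of
    both maps lets [tens_map] be evaluated on pure tensors. *)
Theorem Phi_A_dirac : Phi_A (zcls (dirac_d beta)) = dirac_0 beta e e'.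
Proof.
have UD : {morph @Phi_U F g : x y / x + y}.
  move=> x y; rewrite /Phi_U uenv_base_change_invD.
  exact: (uenv_mapD (@etaD F g) (@etaZ F g) (@eta_lie F g)).
have UZ : scalable (@Phi_U F g).
  move=> c x; rewrite /Phi_U uenv_base_change_invZ.
  exact: (uenv_mapZ (@etaD F g) (@etaZ F g) (@eta_lie F g)).
have ClD : {morph @Phi_Cl F g beta : x y / x + y}.
  move=> x y; rewrite /Phi_Cl (cliff_base_change_invD beta_d_linearl beta_d_linearr).
  exact: (cliff_mapD (@isom_pD F g) (@isom_pZ F g) isom_p_isometry).
have ClZ : scalable (@Phi_Cl F g beta).
  move=> c x; rewrite /Phi_Cl (cliff_base_change_invZ beta_d_linearl beta_d_linearr).
  exact: (cliff_mapZ (@isom_pD F g) (@isom_pZ F g) isom_p_isometry).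
pose u i := uenv_gen (deform_incl (zp (tnth e i))).
pose v i := cliff_gen (beta_d beta) (zp (tnth e' i)).
have zE := zfib_tens_sum (index_enum 'I_m) u v.
have mapE := tens_map_sum (index_enum 'I_m)
  (fun i => zcls (u i)) (fun i => zcls (v i)) UD UZ ClD ClZ.
have dE := congr1 (@Phi_A F g beta) (congr1 (@zcls _ _) dirac_dE).
have mzE := congr1 (tens_map (@Phi_U F g) (@Phi_Cl F g beta)) zE.
(* [Phi_A] must stay folded: unfolded, its body takes minutes to retype. *)
refine (etrans dE (etrans mzE (etrans mapE _))).
apply: eq_bigr => i _; congr tpure.
- rewrite /Phi_U uenv_base_change_inv_gen.
  by rewrite (uenv_map_gen (@etaD F g) (@etaZ F g) (@eta_lie F g)) eta_zp.
- rewrite /Phi_Cl (cliff_base_change_inv_gen beta_d_linearl beta_d_linearr).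
  rewrite (cliff_map_gen (@isom_pD F g) (@isom_pZ F g) isom_p_isometry).
  by rewrite -[zp _]scale1r isom_p_zp hornerC scale1r.
Qed.

End DiracOperator.

End DeformationForm.

Theorem mainTheorem7 (R : realType) (n : nat) (G : set 'M[Cx R]_n)
  (sigma Theta : 'M[Cx R]_n -> 'M[Cx R]_n)
  (g : symLieType (Cx R)) (iota : {linear g -> 'M[Cx R]_n}) (dsigma : g -> g)
  (beta : g -> g -> Cx R)
  (hG : connected_reductive_group G)
  (hsigma : antiholomorphic_involution G sigma)
  (hconn : connected (fixed_points G sigma))
  (hncpt : ~ compact (fixed_points G sigma))
  (hTheta : cartan_involution G sigma Theta)
  (hg : is_lie_algebra_of iota G)
  (hdsigma : is_differential iota sigma dsigma)
  (hdTheta : is_differential iota Theta (@theta (Cx R) g))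
  (hbeta : cartan_form G Theta iota dsigma beta)
  (m : nat) (e e' : m.-tuple (subvs_of (pspace g)))
  (he : basis_of fullv e)
  (hdual : forall i j : 'I_m,
     beta0 beta (tnth e i) (tnth e' j) = (i == j)%:R) :
  Phi_A (zcls (dirac_d beta)) = dirac_0 beta e e'.
Proof.
have [[betaC betal] _ _ _ _] := hbeta.
apply: Phi_A_dirac he hdual => [y a u v|x a u v]; first exact: betal.
(* Linearity in the second variable comes from symmetry. *)
by rewrite ![beta x _]betaC; exact: betal.
Qed.
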